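(* There exists a maximal arithmetic hyperbolic reflection group which is not congruence.
   Context: A hyperbolic reflection group is a (discrete) subgroup of $\mathrm{Isom}(\mathbb{H}^2)$ generated by the reflections in the sides of a finite-sided convex polygon $Q\subset\mathbb{H}^2$ of finite area (ideal vertices allowed), each of whose angles is $0$ or an integer submultiple of $\pi$. Here $\mathbb{H}^2$ is the upper half-plane, and $\mathrm{PSL}_2(\mathbb{Z})<\mathrm{PSL}_2(\mathbb{R})<\mathrm{Isom}(\mathbb{H}^2)$ acts by Möbius transformations. A non-cocompact hyperbolic reflection group is called arithmetic if it is commensurable with $\mathrm{PSL}_2(\mathbb{Z})$, i.e. its intersection with $\mathrm{PSL}_2(\mathbb{Z})$ has finite index in both groups. It is called maximal arithmetic if it is arithmetic and is not properly contained in another arithmetic hyperbolic reflection group. Such an arithmetic group is called congruence if it contains, for some $n\ge 1$, the principal congruence subgroup $$\Gamma(n)=\left\{\pm\begin{pmatrix}a&b\\c&d\end{pmatrix}\in\mathrm{PSL}_2(\mathbb{Z}) : a\equiv d\equiv\pm1,\ b\equiv c\equiv 0 \ \mathrm{mod}\ n\right\}.$$ *)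

(* Defs.v *)
From HB Require Import structures.
From mathcomp Require Import all_boot all_order all_algebra.
From mathcomp Require Import complex.
From mathcomp Require Import all_classical all_reals all_analysis.
From mathcomp Require Import ring lra.

Set Implicit Arguments.
Unset Strict Implicit.
Unset Printing Implicit Defensive.

Import Order.TTheory GRing.Theory Num.Theory.
Import numFieldNormedType.Exports.

Local Open Scope classical_set_scope.
Local Open Scope ring_scope.
Local Open Scope complex_scope.

Record uhp (R : realType) : Type := Uhp { zval :> R[i] ; _ : 0 < complex.Im zval }.

Section HyperbolicPlane.
Variable R : realType.
Implicit Types z w : uhp R.

Definition xc z : R := complex.Re (zval z).
Definition yc z : R := complex.Im (zval z).
Definition coords z : R * R := (xc z, yc z).

Definition arcosh (t : R) : R := ln (t + Num.sqrt (t ^+ 2 - 1)).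

Definition coshdist z w : R :=
  1 + ((xc z - xc w) ^+ 2 + (yc z - yc w) ^+ 2) / (2 * yc z * yc w).

Definition hdist z w : R := arcosh (coshdist z w).

Lemma yc_gt0 z : 0 < yc z. Proof. by case: z. Qed.

Lemma uhp_inj : injective (@zval R).
Proof.
by move=> [z hz] [w hw] /= e; subst w; congr Uhp; exact: Prop_irrelevance.
Qed.

Lemma coords_inj : injective coords.
Proof.
move=> z w [ex ey]; apply: uhp_inj; move: ex ey; rewrite /xc /yc.
by case: (zval z) (zval w) => [a b] [c d] /= -> ->.
Qed.

End HyperbolicPlane.

Record isom (R : realType) : Type := Isom {
  isom_fun :> uhp R -> uhp R;
  isom_inv : uhp R -> uhp R;
  isom_funK : cancel isom_fun isom_inv;
  isom_invK : cancel isom_inv isom_fun;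
  isom_hdist : forall z w, hdist (isom_fun z) (isom_fun w) = hdist z w
}.

Section IsometryGroup.
Variable R : realType.
Implicit Types g h : isom R.

Lemma isom_ext g h : (forall z, g z = h z) -> g = h.
Proof.
case: g h => [f f' fK f'K df] [k k' kK k'K dk] /= /funext e.
subst k; have e' : f' = k' by apply/funext => z; rewrite -{1}(k'K z) fK.
subst k'; congr Isom; exact: Prop_irrelevance.
Qed.

Definition isom_id : isom R :=
  @Isom R id id (fun=> erefl) (fun=> erefl) (fun _ _ => erefl).

Lemma isom_hdistV g z w : hdist (isom_inv g z) (isom_inv g w) = hdist z w.
Proof. by rewrite -(isom_hdist g) !isom_invK. Qed.

Definition isom_inverse g : isom R :=
  Isom (isom_invK g) (isom_funK g) (isom_hdistV g).

Lemma isom_hdist_comp g h z w : hdist ((g \o h) z) ((g \o h) w) = hdist z w.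
Proof. by rewrite /= !isom_hdist. Qed.

Definition isom_comp g h : isom R :=
  Isom (can_comp (isom_funK g) (isom_funK h))
       (can_comp (isom_invK h) (isom_invK g)) (isom_hdist_comp g h).

HB.instance Definition _ := gen_eqMixin (isom R).
HB.instance Definition _ := gen_choiceMixin (isom R).

Lemma isom_mulA : associative isom_comp.
Proof. by move=> f g h; apply: isom_ext. Qed.
Lemma isom_mul1 : left_id isom_id isom_comp.
Proof. by move=> f; apply: isom_ext. Qed.
Lemma isom_mulr1 : right_id isom_id isom_comp.
Proof. by move=> f; apply: isom_ext. Qed.
Lemma isom_mulV : left_inverse isom_id isom_inverse isom_comp.
Proof. by move=> f; apply: isom_ext => z /=; rewrite isom_funK. Qed.
Lemma isom_mulrV : right_inverse isom_id isom_inverse isom_comp.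
Proof. by move=> f; apply: isom_ext => z /=; rewrite isom_invK. Qed.

HB.instance Definition _ := isGroup.Build (isom R)
  isom_mulA isom_mul1 isom_mulr1 isom_mulV isom_mulrV.

Lemma isom1E z : (1%g : isom R) z = z. Proof. by []. Qed.
Lemma isomME g h z : (g * h)%g z = g (h z). Proof. by []. Qed.

End IsometryGroup.

Section Groups.
Variable gT : groupType.
Implicit Types G K S : set gT.

Definition is_subgroup G : Prop :=
  G 1%g /\ forall g h, G g -> G h -> G (g * h^-1)%g.

Definition generated S : set gT := smallest is_subgroup S.

(* Meant for subgroups K of G: there are finitely many left cosets gK. *)
Definition finite_index K G : Prop :=
  finite_set [set [set (g * k)%g | k in K] | g in G].

Definition commensurable G1 G2 : Prop :=
  finite_index (G1 `&` G2) G1 /\ finite_index (G1 `&` G2) G2.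

End Groups.

Section Moebius.
Variable R : realType.
Implicit Types z w : uhp R.

Lemma mobius_coords (p q r s x y : R) :
  (r * x + s) ^+ 2 + (r * y) ^+ 2 != 0 ->
  (p%:C * (x +i* y) + q%:C) / (r%:C * (x +i* y) + s%:C) =
  (((p * x + q) * (r * x + s) + p * r * y ^+ 2) /
      ((r * x + s) ^+ 2 + (r * y) ^+ 2)) +i*
  ((p * s - q * r) * y / ((r * x + s) ^+ 2 + (r * y) ^+ 2)).
Proof.
move=> N0.
have inv (a b : R) : (a +i* b)^-1 =
  (a / (a ^+ 2 + b ^+ 2)) +i* (- (b / (a ^+ 2 + b ^+ 2))) by [].
have -> : r%:C * (x +i* y) + s%:C = (r * x + s) +i* (r * y) by simpc.
have -> : p%:C * (x +i* y) + q%:C = (p * x + q) +i* (p * y) by simpc.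
by rewrite inv; simpc; congr Complex; field.
Qed.

Lemma mobius_den_gt0 (p q r s x y : R) : p * s - q * r != 0 -> y != 0 ->
  0 < (r * x + s) ^+ 2 + (r * y) ^+ 2.
Proof.
move=> d0 y0; rewrite lt_neqAle eq_sym addr_ge0 ?sqr_ge0 ?andbT //.
rewrite paddr_eq0 ?sqr_ge0 // !sqrf_eq0 mulf_eq0 (negPf y0) orbF.
apply/negP => /andP[/eqP e /eqP r0]; move: e d0; rewrite r0 mul0r add0r => ->.
by rewrite !mulr0 subrr eqxx.
Qed.

(* Direct maps for e = 1, orientation-reversing ones for e = -1. *)
Lemma mobius_coshdist (p q r s e : R) (f : uhp R -> uhp R) :
  0 < e * (p * s - q * r) -> e ^+ 2 = 1 ->
  (forall z, zval (f z) = (p%:C * (xc z +i* (e * yc z)) + q%:C) /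
                          (r%:C * (xc z +i* (e * yc z)) + s%:C)) ->
  forall z w, hdist (f z) (f w) = hdist z w.
Proof.
move=> d0 e2 fE z w; rewrite /hdist; congr arcosh.
have yz := yc_gt0 z; have yw := yc_gt0 w.
have e0 : e != 0 by apply: contraPneq e2 => ->; rewrite expr0n /=; lra.
have D0 : p * s - q * r != 0.
  by apply: contraTneq d0 => ->; rewrite mulr0 ltxx.
have Nz := mobius_den_gt0 (xc z) D0 (mulf_neq0 e0 (lt0r_neq0 yz)).
have Nw := mobius_den_gt0 (xc w) D0 (mulf_neq0 e0 (lt0r_neq0 yw)).
have xE (t : uhp R) : xc t = complex.Re (zval t) by [].
have yE (t : uhp R) : yc t = complex.Im (zval t) by [].
rewrite /coshdist (xE (f z)) (xE (f w)) (yE (f z)) (yE (f w)) !fE.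
clear xE yE; rewrite !mobius_coords ?gt_eqF //=.
congr (1 + _).
move: Nz Nw yz yw.
set x := xc z; set y := yc z; set u := xc w; set v := yc w => Nz Nw yz yw.
have Ee : e = 1 \/ e = -1.
  have /eqP : (e - 1) * (e + 1) = 0 by rewrite -subr_sqr e2; ring.
  by rewrite mulf_eq0 subr_eq0 addr_eq0 => /orP[] /eqP ->; [left|right].
clearbody x y u v.
case: Ee => Ee; rewrite {}Ee in Nz Nw *; field.
- by rewrite !mul1r in Nz Nw; rewrite D0 !gt_eqF.
- by rewrite D0 !gt_eqF.
Qed.

Lemma mobius_den_neq0 (p q r s : R) (z : R[i]) : p * s - q * r != 0 ->
  complex.Im z != 0 -> r%:C * z + s%:C != 0.
Proof.
case: z => x y /= D0 y0; have := mobius_den_gt0 x D0 y0.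
apply: contraTneq; simpc => -[-> ->].
by rewrite expr0n /= addr0 ltxx.
Qed.

Lemma mobius_Im_gt0 (p q r s : R) (z : R[i]) :
  0 < (p * s - q * r) * complex.Im z ->
  0 < complex.Im ((p%:C * z + q%:C) / (r%:C * z + s%:C)).
Proof.
case: z => x y D0; rewrite /= in D0.
have N0 : 0 < (r * x + s) ^+ 2 + (r * y) ^+ 2.
  by apply: (@mobius_den_gt0 p q); apply: contraTneq D0 => ->;
    rewrite ?mulr0 ?mul0r ltxx.
by rewrite mobius_coords ?gt_eqF //= divr_gt0.
Qed.

Lemma mobius_comp (p q r s : R) (z : R[i]) : p * s - q * r != 0 ->
  complex.Im z != 0 ->
  let w := (p%:C * z + q%:C) / (r%:C * z + s%:C) in
  (s%:C * w + (- q)%:C) / ((- r)%:C * w + p%:C) = z.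
Proof.
move=> D0 y0 /=; have den := mobius_den_neq0 D0 y0.
have frac (F : fieldType) (P Q T S t : F) : P * S - Q * T != 0 ->
    T * t + S != 0 ->
    (S * ((P * t + Q) / (T * t + S)) + - Q) /
    (- T * ((P * t + Q) / (T * t + S)) + P) = t.
  move=> d0 t0; field; rewrite t0 /=.
  by have -> : - T * (P * t + Q) + P * (T * t + S) = P * S - Q * T by ring.
rewrite !rmorphN; apply: frac den.
by rewrite -!rmorphM -rmorphB fmorph_eq0.
Qed.

Lemma mobius_isom (p q r s : R) : 0 < p * s - q * r ->
  exists g : isom R, forall z,
    g z = (p%:C * zval z + q%:C) / (r%:C * zval z + s%:C) :> R[i].
Proof.
move=> D0.
have D0' : 0 < s * p - - q * - r by rewrite mulrNN [s * p]mulrC.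
pose f z := Uhp (mobius_Im_gt0 (mulr_gt0 D0 (yc_gt0 z))).
pose f' z := Uhp (mobius_Im_gt0 (mulr_gt0 D0' (yc_gt0 z))).
have fK : cancel f f'.
  by move=> z; apply/uhp_inj/mobius_comp; rewrite gt_eqF ?yc_gt0.
have f'K : cancel f' f.
  move=> z; apply/uhp_inj => /=.
  have := @mobius_comp s (- q) (- r) p (zval z); rewrite !opprK; apply.
    by rewrite gt_eqF.
  by rewrite gt_eqF ?(yc_gt0 z).
have fd : forall z w, hdist (f z) (f w) = hdist z w.
  apply: (@mobius_coshdist p q r s 1); rewrite ?mul1r ?expr1n // => z /=.
  by rewrite mul1r /xc /yc; case: (zval z).
by exists (Isom fK f'K fd).
Qed.

End Moebius.

(* The geodesics of the upper half-plane are the half-circles centred on the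
   real axis and the vertical half-lines, that is, the zero sets of
   a |z|^2 + b Re z + c with b^2 - 4ac > 0; the sign of the form selects one of
   the two half-planes.  Proportional forms describe the same geodesic. *)
Record hform (R : realType) : Type := HForm {
  qa : R; qb : R; qc : R;
  disc_gt0 : 0 < qb ^+ 2 - 4 * qa * qc
}.

Section Geometry.
Variable R : realType.
Implicit Types (l : hform R) (z w : uhp R) (Q : set (uhp R)) (G : set (isom R)).

Definition hform_val l z : R :=
  qa l * (xc z ^+ 2 + yc z ^+ 2) + qb l * xc z + qc l.

Definition geodesic l : set (uhp R) := [set z | hform_val l z = 0].

Definition halfplane l : set (uhp R) := [set z | 0 <= hform_val l z].

(* For a = 0 this is z |-> - z^* - 2c/b; for a <> 0, with centre p = -b/2a and
   radius r, r^2 = (b^2 - 4ac)/4a^2, it is the inversion p + r^2/(z^* - p). *)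
Definition reflection_val l (z : R[i]) : R[i] :=
  ((- qb l)%:C * conjc z + (- (2 * qc l))%:C) /
  ((2 * qa l)%:C * conjc z + (qb l)%:C).

Lemma reflection_det l :
  - qb l * qb l - (- (2 * qc l)) * (2 * qa l) = - (qb l ^+ 2 - 4 * qa l * qc l).
Proof. by ring. Qed.

Lemma reflection_val_gt0 l z : 0 < complex.Im (reflection_val l (zval z)).
Proof.
apply: mobius_Im_gt0; rewrite reflection_det.
have := mulr_gt0 (disc_gt0 l) (yc_gt0 z).
by rewrite /yc; case: (zval z) => x y /=; rewrite mulrNN.
Qed.

Definition reflection_fun l z : uhp R := Uhp (reflection_val_gt0 l z).

Lemma reflection_funK l : involutive (reflection_fun l).
Proof.
move=> z; apply: uhp_inj => /=.
have D0 : - qb l * qb l - (- (2 * qc l)) * (2 * qa l) != 0.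
  by rewrite reflection_det oppr_eq0 gt_eqF ?disc_gt0.
rewrite -[RHS](mobius_comp D0 (z := zval z)) ?gt_eqF ?(yc_gt0 z) //.
have conjr (x : R) : conjc x%:C = x%:C by rewrite /= oppr0.
have conjV (x y : R[i]) : conjc (x / y) = conjc x / conjc y by exact: fmorph_div.
have conjD (x y : R[i]) : conjc (x + y) = conjc x + conjc y by exact: rmorphD.
have conjM (x y : R[i]) : conjc (x * y) = conjc x * conjc y by exact: rmorphM.
rewrite /reflection_val conjV !conjD !conjM !conjr !conjcK.
have rN (x : R) : (- x)%:C = - x%:C by rewrite rmorphN.
set w := (_ / ((2 * qa l)%:C * zval z + _)); clearbody w.
by rewrite !rN opprK -[LHS]mulrNN -invrN !opprD !mulNr !opprK.
Qed.

Lemma reflection_hdist l z w :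
  hdist (reflection_fun l z) (reflection_fun l w) = hdist z w.
Proof.
apply: (@mobius_coshdist R (- qb l) (- (2 * qc l)) (2 * qa l) (qb l) (-1)).
- by rewrite reflection_det mulN1r opprK disc_gt0.
- by rewrite sqrrN expr1n.
- by move=> t; rewrite mulN1r /= /reflection_val /xc /yc; case: (zval t).
Qed.

Definition reflection l : isom R :=
  Isom (reflection_funK l) (reflection_funK l) (@reflection_hdist l).

Lemma reflection_fixE l z : reflection l z = z <-> geodesic l z.
Proof.
have den : (2 * qa l)%:C * conjc (zval z) + (qb l)%:C != 0.
  apply: (@mobius_den_neq0 R (- qb l) (- (2 * qc l))).
    by rewrite reflection_det oppr_eq0 gt_eqF ?disc_gt0.
  by have := yc_gt0 z; rewrite /yc; case: (zval z) => x y /= y0;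
    rewrite oppr_eq0 gt_eqF.
have key : (- qb l)%:C * conjc (zval z) + (- (2 * qc l))%:C -
    zval z * ((2 * qa l)%:C * conjc (zval z) + (qb l)%:C) =
    (- (2 * hform_val l z))%:C.
  by rewrite /hform_val /xc /yc; case: (zval z) => x y /=; simpc;
    congr Complex; ring.
have eqF : reflection l z = z <-> hform_val l z = 0.
  split=> [e|e].
    have := congr1 (@zval R) e; rewrite /= /reflection_val => /(canRL (divfK den)).
    move/eqP; rewrite -subr_eq0 key => /eqP[] /eqP.
    by rewrite oppr_eq0 mulf_eq0 pnatr_eq0 /= => /eqP.
  apply: uhp_inj; rewrite /= /reflection_val; apply: (canLR (mulfK den)).
  by apply/eqP; rewrite -subr_eq0 key e mulr0 oppr0.
exact: eqF.
Qed.

Definition convex_polygon Q : Prop :=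
  (exists (n : nat) (l : 'I_n -> hform R),
     Q = [set z | forall i, halfplane (l i) z]) /\
  (exists z e, 0 < e /\ forall w, hdist z w < e -> Q w).

(* Area for dx dy / y^2. *)
Definition harea Q : \bar R :=
  (\int[(@lebesgue_measure R \x @lebesgue_measure R)]_(p in @coords R @` Q)
     ((p.2 ^- 2)%:E))%E.

(* A side is the intersection of Q with the boundary of a half-plane containing
   Q when it is not reduced to a point; it is represented by that half-plane. *)
Definition side_of Q l : Prop :=
  Q `<=` halfplane l /\
  exists z w, [/\ z <> w, (Q `&` geodesic l) z & (Q `&` geodesic l) w].

(* The Euclidean gradient of the form at z; on the geodesic it is a normal
   vector pointing into the half-plane. *)
Definition grad l z : R * R := (2 * qa l * xc z + qb l, 2 * qa l * yc z).

Definition dot (u v : R * R) : R := u.1 * v.1 + u.2 * v.2.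

(* Interior angle at z, a common point of the two boundary geodesics, of the
   intersection of the two half-planes: pi minus the angle between the inner
   normals.  Hyperbolic angles are Euclidean ones. *)
Definition interior_angle l1 l2 z : R :=
  pi - acos (dot (grad l1 z) (grad l2 z) /
    (Num.sqrt (dot (grad l1 z) (grad l1 z)) *
     Num.sqrt (dot (grad l2 z) (grad l2 z)))).

(* At an ideal vertex the angle is 0, so that only the vertices inside the
   hyperbolic plane are constrained. *)
Definition submultiple_angles Q : Prop :=
  forall l1 l2 z, side_of Q l1 -> side_of Q l2 -> geodesic l1 <> geodesic l2 ->
    Q z -> geodesic l1 z -> geodesic l2 z ->
    exists n : nat, (0 < n)%N /\ interior_angle l1 l2 z = pi / n%:R.

(* The identity is isolated in G for the topology of pointwise convergence,
   which on isometries is the compact-open topology. *)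
Definition discrete_subgroup G : Prop :=
  exists (F : set (uhp R)) (e : R), [/\ finite_set F, 0 < e &
    forall g, G g -> (forall z, F z -> hdist (g z) z < e) -> g = 1%g].

Definition cocompact G : Prop :=
  exists K : set (uhp R), compact (@coords R @` K) /\
    forall z, exists g w, [/\ G g, K w & z = g w].

Definition hyperbolic_reflection_group G : Prop :=
  discrete_subgroup G /\
  exists Q, [/\ convex_polygon Q, (harea Q < +oo)%E, submultiple_angles Q &
    G = generated [set reflection l | l in side_of Q]].

Definition acts_as (A : 'M[int]_2) (g : isom R) : Prop :=
  forall z, g z = ((A 0 0)%:~R * zval z + (A 0 1)%:~R) /
                  ((A 1 0)%:~R * zval z + (A 1 1)%:~R) :> R[i].

Lemma acts_as_exists (A : 'M[int]_2) : \det A = 1 -> exists g, acts_as A g.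
Proof.
move=> dA; have {}dA : A 0 0 * A 1 1 - A 0 1 * A 1 0 = 1.
  rewrite -dA (expand_det_row _ 0) big_ord_recl big_ord1 /cofactor !det_mx11.
  rewrite !mxE /= expr0 mul1r expr1 mulN1r mulrN.
  by congr (A _ _ * A _ _ - A _ _ * A _ _); exact/val_inj.
have d0 : 0 < (A 0 0)%:~R * (A 1 1)%:~R - (A 0 1)%:~R * (A 1 0)%:~R :> R.
  by rewrite -!intrM -intrB dA ltr01.
have [g gE] := mobius_isom d0.
by exists g => z; rewrite gE !rmorph_int.
Qed.

Definition PSL2Z : set (isom R) :=
  [set g | exists A : 'M[int]_2, \det A = 1 /\ acts_as A g].

(* The sign is common to both diagonal entries. *)
Definition principal_congruence (n : nat) : set (isom R) :=
  [set g | exists A : 'M[int]_2, [/\ \det A = 1, acts_as A g,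
     (A 0%R 1%R = 0 %[mod n])%Z /\ (A 1%R 0%R = 0 %[mod n])%Z &
     (A 0%R 0%R = 1 %[mod n])%Z /\ (A 1%R 1%R = 1 %[mod n])%Z \/
     (A 0%R 0%R = -1 %[mod n])%Z /\ (A 1%R 1%R = -1 %[mod n])%Z]].

Definition arithmetic_reflection_group G : Prop :=
  [/\ hyperbolic_reflection_group G, ~ cocompact G & commensurable G PSL2Z].

Definition maximal_arithmetic G : Prop :=
  arithmetic_reflection_group G /\
  forall G', arithmetic_reflection_group G' -> G `<=` G' -> G' = G.

(* n = 0 is excluded: it would give the trivial group. *)
Definition congruence_group G : Prop :=
  exists n : nat, (0 < n)%N /\ principal_congruence n `<=` G.

End Geometry.

(* Main.v *)
(** Let Q be the right-angled hexagon, with two ideal vertices at oo and 1/3, whose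
    sides are the six geodesics 11 A |z|^2 + b Re z + c = 0 listed in [wall], and G
    the group generated by the reflections in them.

    Not congruence: G contains z + 1 and its conjugate z / (11 z + 1), so if it
    contained Gamma(n), it would contain every matrix congruent mod n to a word in
    these two elements.  The image of [[23, 5], [55, 12]] modulo n is such a word,
    whereas this matrix is, up to an element of G, the rotation of Q by pi about
    its centre z0, which is not in G since only 1 fixes z0 in G.

    Maximal: if G' contains G and is commensurable with PSL2(Z), and r is a
    reflection in G', then the conjugates by r of the parabolic elements of G have
    a power in PSL2(Z), so the geodesic of r is rational; the products of r with
    reflections in the sides also have a power in PSL2(Z), which bounds the
    denominator of their traces and makes r a reflection in a root of the lattice of
    forms.  Descent on the value at z0 shows that all these reflections lie in G. *)

From Stdlib Require Import ZArith Lia.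
From HB Require Import structures.
From mathcomp Require Import all_boot.

Set Implicit Arguments.
Unset Strict Implicit.
Unset Printing Implicit Defensive.

Local Arguments Z.mul : simpl never.
Local Arguments Z.add : simpl never.
Local Arguments Z.sub : simpl never.
Local Arguments Z.opp : simpl never.

(** No theorem on fundamental polygons is invoked. Isometries in G are studied through their action
    on the integer forms (A, b, c), where the six walls behave like the simple roots of a Coxeter
    group and [height] like the pairing with a Weyl vector: every wall has height 1, and reflecting
    in a wall lowers the height by exactly the pairing. The deletion argument and the descent
    thereby become integer statements, whose core, [negated_root], is a finite search; discreteness
    comes from the integrality of the same action.

    The number 11 is the level. The rotation about z0 has the matrix [[11, -4], [33, -11]] of
    determinant 11, which preserves the lattice of forms; so integrality conditions alone cannot
    tell it from an element of G. The reflections in all roots of this lattice lie in G, yet they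
    miss this one symmetry of the polygon, which is what makes G both maximal among reflection
    groups and not congruence. *)

Section IntegerArithmetic.
Local Open Scope Z_scope.

(* The triple (A, b, c) stands for the form 11 A |z|^2 + b Re z + c. *)
Record iform := Form { fa : Z; fb : Z; fc : Z }.

(** * Walls, roots and heights in the lattice of integer forms *)

Inductive side := S0 | S1 | S2 | S3 | S4 | S5.

Definition wall (i : side) : iform :=
  match i with
  | S0 => Form 0 1 0 | S1 => Form 0 (-2) 1 | S2 => Form 2 (-22) 5
  | S3 => Form 3 (-23) 4 | S4 => Form 3 (-20) 3 | S5 => Form 1 0 (-1)
  end.

Definition disc (v : iform) : Z := fb v * fb v - 44 * fa v * fc v.

(* A positive multiple of the value of the form at the centre
   z0 = (11 + i sqrt 11) / 33 of the polygon; the walls all have height 1. *)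
Definition height (v : iform) : Z := 4 * fa v + fb v + 3 * fc v.

(* 2 (v, e) / (e, e) for the wall e, in the bilinear form polarising disc. *)
Definition pairing (i : side) (v : iform) : Z :=
  match i with
  | S0 => 2 * fb v | S1 => - (fb v + 11 * fa v)
  | S2 => - (fb v + 5 * fa v + 2 * fc v)
  | S3 => - (46 * fb v + 176 * fa v + 132 * fc v)
  | S4 => - (10 * fb v + 33 * fa v + 33 * fc v)
  | S5 => fa v - fc v
  end.

Definition fscale (t : Z) (v : iform) : iform :=
  Form (t * fa v) (t * fb v) (t * fc v).

Definition wrefl (i : side) (v : iform) : iform :=
  let n := pairing i v in
  Form (fa v - n * fa (wall i)) (fb v - n * fb (wall i)) (fc v - n * fc (wall i)).

(* For primitive v, the condition under which the reflection in v preserves the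
   lattice of forms. *)
Definition is_root (v : iform) : Prop :=
  disc v = 1 \/ (disc v = 4 /\ exists k, fb v = 2 * k) \/
  (disc v = 44 /\ exists k, fb v = 22 * k).

Lemma disc_wrefl i v : disc (wrefl i v) = disc v.
Proof. by case: v => A b c; case: i; rewrite /disc /=; ring. Qed.

Lemma height_wrefl i v : height (wrefl i v) = height v - pairing i v.
Proof. by case: v => A b c; case: i; rewrite /height /=; ring. Qed.

Lemma wrefl_root i v : is_root v -> is_root (wrefl i v).
Proof.
rewrite /is_root disc_wrefl => -[|[[-> H]|[-> H]]]; [by left|right; left|right; right].
  move: H => [k]; case: v => A b c /= ->; split=> //.
  case: i => /=.
  - by exists (- k); lia.
  - by exists (k - (2 * k + 11 * A)); lia.
  - by exists (k - 11 * (2 * k + 5 * A + 2 * c)); lia.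
  - by exists (k - 23 * (46 * k + 88 * A + 66 * c)); lia.
  - by exists (k - 10 * (20 * k + 33 * A + 33 * c)); lia.
  - by exists k; lia.
move: H => [k]; case: v => A b c /= ->; split=> //.
case: i => /=.
- by exists (- k); lia.
- by exists (k - (2 * k + A)); lia.
- by exists (k - (22 * k + 5 * A + 2 * c)); lia.
- by exists (k - 23 * (46 * k + 8 * A + 6 * c)); lia.
- by exists (k - 10 * (20 * k + 3 * A + 3 * c)); lia.
- by exists k; lia.
Qed.

Lemma wall_root i : is_root (wall i).
Proof.
case: i; rewrite /is_root /disc /=.
- by left.
- by right; left; split=> //; exists (-1).
- by right; right; split=> //; exists (-1).
- by left.
- by right; left; split=> //; exists (-10).
- by right; right; split=> //; exists 0.
Qed.

(** Finite area in algebraic form: the cone on which no pairing is positive contains only forms of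
    nonpositive discriminant. Every descent starts from this. *)
Lemma disc_gt0_pairing v : 0 < disc v -> exists i, 0 < pairing i v.
Proof.
move=> D0.
have H : 0 < pairing S0 v \/ 0 < pairing S1 v \/ 0 < pairing S2 v \/
  0 < pairing S3 v \/ 0 < pairing S4 v \/ 0 < pairing S5 v.
  case: v D0 => A b c; rewrite /disc /= => D0.
  suff : ~ (2 * b <= 0 /\ - (b + 11 * A) <= 0 /\ - (b + 5 * A + 2 * c) <= 0 /\
    - (46 * b + 176 * A + 132 * c) <= 0 /\ - (10 * b + 33 * A + 33 * c) <= 0 /\
    A - c <= 0) by lia.
  move=> [h0 [h1 [h2 [h3 [h4 h5]]]]].
  have A0 : 0 <= A by lia.
  have c0 : 0 <= c by lia.
  (* For each ratio c / A one wall bounds b well enough: [S4], [S3], [S2], [S1] in turn. The ratios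
     11/9 and 16/11 belong to the forms with a double zero at 1/3 and at 4/11, the endpoints of the
     geodesic of [S3], whose inequality suffices exactly between them. *)
  case: (Z.le_gt_cases (9 * c) (11 * A)) => t1; first by nia.
  case: (Z.le_gt_cases (11 * c) (16 * A)) => t2.
    have : (16 * A - 11 * c) * (11 * A - 9 * c) <= 0 by nia.
    have : (23 * b) * (23 * b) <= (88 * A + 66 * c) * (88 * A + 66 * c) by nia.
    by lia.
  case: (Z.le_gt_cases c (4 * A)) => t3.
    have : (11 * c - 16 * A) * (c - 4 * A) <= 0 by nia.
    have : b * b <= (5 * A + 2 * c) * (5 * A + 2 * c) by nia.
    have : A * A <= A * c by nia.
    by lia.
  have : b * b <= (11 * A) * (11 * A) by nia.
  by nia.
by case: H => [|[|[|[|[|]]]]] H; eexists; exact: H.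
Qed.

(** * Finite search for the roots made negative by a wall *)

Definition rootdisc (d : Z) : bool := ((d =? 1) || (d =? 4) || (d =? 44))%bool.

Lemma is_root_disc v : is_root v -> rootdisc (disc v).
Proof. by rewrite /rootdisc => -[->|[[-> _]|[-> _]]]. Qed.

Lemma rootdisc_le d : rootdisc d -> 0 < d <= 44.
Proof.
by rewrite /rootdisc; do 3 (case: Z.eqb_spec => [->|_] /=; first by lia).
Qed.

Definition all_between (lo hi : Z) (f : Z -> bool) : bool :=
  List.forallb (fun k => f (lo + Z.of_nat k)) (List.seq 0 (Z.to_nat (hi - lo + 1))).

Lemma all_betweenP lo hi f x : all_between lo hi f -> lo <= x <= hi -> f x.
Proof.
move=> /List.forallb_forall H [h1 h2].
have -> : x = lo + Z.of_nat (Z.to_nat (x - lo)) by lia.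
by apply: H; apply/List.in_seq; lia.
Qed.

Lemma mul_le_abs l x X : - X <= x <= X ->
  l * x <= Z.abs l * X /\ 0 <= Z.abs l * X.
Proof. by move=> hx; split; nia. Qed.

Section NegatedRoot.
Variables p q r d l m X Y : Z.
Let D := 4 * p * r - q * q.

Definition no_negated_root : bool :=
  all_between (- X) X (fun x => all_between (- Y) Y (fun y =>
    all_between 1 (44 + Z.abs l * X + Z.abs m * Y) (fun u =>
      implb ((0 <=? u - (l * x + m * y)) &&
             rootdisc (p * x * x + q * x * y + r * y * y +
                       d * u * (u - (l * x + m * y))))
            ((x =? 0) && (y =? 0))))).

Lemma no_negated_rootP x y u : 0 < p -> 0 < r -> 0 < d -> 0 <= X -> 0 <= Y ->
  176 * r < D * (X + 1) * (X + 1) -> 176 * p < D * (Y + 1) * (Y + 1) -> 0 < D ->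
  no_negated_root ->
  0 < u -> 0 <= u - (l * x + m * y) ->
  rootdisc (p * x * x + q * x * y + r * y * y + d * u * (u - (l * x + m * y))) ->
  x = 0 /\ y = 0.
Proof.
move=> p0 r0 d0 X0 Y0 hX hY D0 chk u0 w0 rD.
have [_ le44] := rootdisc_le rD.
set w := u - _ in w0 rD le44.
have uw : 0 <= u * w by nia.
have duw : u * w <= d * (u * w) by nia.
have q44 : p * x * x + q * x * y + r * y * y <= 44 by lia.
(* Completing the square in the definite form, whose value is at most 44, the largest discriminant
   of a root; 176 is 4 times 44. *)
have sx : D * (x * x) <= 176 * r.
  have := Z.square_nonneg (2 * r * y + q * x).
  have : 4 * r * (p * x * x + q * x * y + r * y * y) <= 4 * r * 44 by nia.
  by rewrite /D; lia.
have sy : D * (y * y) <= 176 * p.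
  have := Z.square_nonneg (2 * p * x + q * y).
  have : 4 * p * (p * x * x + q * x * y + r * y * y) <= 4 * p * 44 by nia.
  by rewrite /D; lia.
have bnd B z : 0 <= B -> D * (z * z) < D * ((B + 1) * (B + 1)) -> - B <= z <= B.
  move=> B0 /(Z.mul_lt_mono_pos_l _ _ _ D0) zB.
  have {}zB : Z.abs z * Z.abs z < (B + 1) * (B + 1) by nia.
  have := Z.square_lt_simpl_nonneg (Z.abs z) (B + 1) ltac:(lia) zB; lia.
have hx : - X <= x <= X by apply: bnd => //; lia.
have hy : - Y <= y <= Y by apply: bnd => //; lia.
have q0 : 0 <= p * x * x + q * x * y + r * y * y.
  have := Z.square_nonneg (2 * p * x + q * y).
  have : 0 <= D * (y * y) by nia.
  have -> : (2 * p * x + q * y) * (2 * p * x + q * y) =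
    4 * p * (p * x * x + q * x * y + r * y * y) - D * (y * y).
    by rewrite /D; ring.
  by nia.
(* Either w = 0, and u is the bounded linear form l x + m y, or w is at least 1, and u is at most u
   w, hence at most 44. *)
have hu : 1 <= u <= 44 + Z.abs l * X + Z.abs m * Y.
  split; first lia.
  have [lx lX] := mul_le_abs l hx; have [my mY] := mul_le_abs m hy.
  case: (Z.eq_dec w 0) => [w00|w1]; first by rewrite /w in w00; lia.
  have u1 : u * 1 <= u * w by apply: Z.mul_le_mono_nonneg_l; lia.
  by lia.
move: chk => /all_betweenP /(_ hx) /all_betweenP /(_ hy) /all_betweenP /(_ hu).
move: w0 rD; rewrite /w => /Z.leb_le -> ->.
by move=> /andP[/Z.eqb_spec -> /Z.eqb_spec ->].
Qed.

End NegatedRoot.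

(* In coordinates where height is one of the variables u and the wall is the
   corresponding basis vector, disc is the sum of a positive definite form in
   the other two and of (e, e) height (pairing - height), which is nonnegative
   here: this leaves finitely many forms. *)
Lemma negated_root i v : is_root v -> 0 < height v <= pairing i v ->
  v = fscale (height v) (wall i).
Proof.
move=> /is_root_disc; case: v => A b c; rewrite /disc /height /fscale /= => rD hn.
case: i hn => /= hn.
- have [] := @no_negated_rootP 5 2 9 (1) (-14) (6) (3) (2)
    (- A) (c - A) (4 * A + b + 3 * c); try lia.
  + by vm_compute.
  + by move: rD; congr (is_true (rootdisc _)); ring.
  + by move=> hx hy; congr Form; lia.
- have [] := @no_negated_rootP 5 2 9 (4) (-4) (-3) (3) (2)
    (- A) (- (5 * A + b + 2 * c)) (4 * A + b + 3 * c); try lia.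
  + by vm_compute.
  + by move: rD; congr (is_true (rootdisc _)); ring.
  + by move=> hx hy; congr Form; lia.
- have [] := @no_negated_rootP 9 16 12 44 (-1) (-1) 3 3
    (- (6 * A + b + 2 * c)) (- (7 * A + 2 * b + 6 * c)) (4 * A + b + 3 * c); try lia.
  + by vm_compute.
  + by move: rD; congr (is_true (rootdisc _)); ring.
  + by move=> hx hy; congr Form; lia.
- have [] := @no_negated_rootP 9 (-2) 5 1 (-6) (-14) 2 3
    (- (5 * A + b + 2 * c)) (- (11 * A + 3 * b + 9 * c)) (4 * A + b + 3 * c); try lia.
  + by vm_compute.
  + by move: rD; congr (is_true (rootdisc _)); ring.
  + by move=> hx hy; congr Form; lia.
- have [] := @no_negated_rootP 9 (-2) 5 4 3 (-4) 2 3
    (c - A) (- (11 * A + 3 * b + 9 * c)) (4 * A + b + 3 * c); try lia.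
  + by vm_compute.
  + by move: rD; congr (is_true (rootdisc _)); ring.
  + by move=> hx hy; congr Form; lia.
- have [] := @no_negated_rootP 5 2 9 (44) (0) (-1) (3) (2)
    (- (3 * A + b + 3 * c)) (- (7 * A + 2 * b + 7 * c)) (4 * A + b + 3 * c); try lia.
  + by vm_compute.
  + by move: rD; congr (is_true (rootdisc _)); ring.
  + by move=> hx hy; congr Form; lia.
Qed.

(** * Words in the wall reflections acting on forms *)

Definition act (v : iform) (w : seq side) : iform := foldl (fun u i => wrefl i u) v w.

Lemma disc_act v w : disc (act v w) = disc v.
Proof. by elim: w v => [|i w IHw] v //=; rewrite IHw disc_wrefl. Qed.

Lemma wrefl_scale i t v : wrefl i (fscale t v) = fscale t (wrefl i v).
Proof. by case: v => A b c; case: i; congr Form => /=; ring. Qed.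

Lemma act_scale t v w : act (fscale t v) w = fscale t (act v w).
Proof. by elim: w v => [|i w IHw] v //=; rewrite wrefl_scale. Qed.

Lemma wrefl_wall i : wrefl i (wall i) = fscale (- 1) (wall i).
Proof. by case: i. Qed.

Lemma height_scale t v : height (fscale t v) = t * height v.
Proof. by case: v => A b c; rewrite /height /=; ring. Qed.

Lemma height_wall i : height (wall i) = 1.
Proof. by case: i. Qed.

Lemma disc_scale t v : disc (fscale t v) = t * t * disc v.
Proof. by case: v => A b c; rewrite /disc /=; ring. Qed.

Lemma disc_wall_gt0 i : 0 < disc (wall i).
Proof. by case: i. Qed.

Lemma is_root_disc_gt0 v : is_root v -> 0 < disc v.
Proof. by move=> /is_root_disc /rootdisc_le []. Qed.

(** The exchange condition: if the next reflection makes a positive height nonpositive, then the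
    height is at most the pairing, and [negated_root] forces the current form to be a multiple of
    that very wall. *)
Lemma act_crossing v w : is_root v -> 0 < height v -> height (act v w) <= 0 ->
  exists p j q, w = p ++ j :: q /\ exists t, t <> 0 /\ act v p = fscale t (wall j).
Proof.
elim: w v => [|j w IHw] v rv h0 /= hw; first by lia.
have hE := height_wrefl j v.
case: (Z.le_gt_cases (height (wrefl j v)) 0) => hj.
  exists [::], j, w; split=> //; exists (height v); split; first by lia.
  by apply: (@negated_root j v rv); lia.
have [p [k [q [-> tE]]]] := IHw _ (wrefl_root j rv) hj hw.
by exists (j :: p), k, q.
Qed.

Lemma wreflK i : involutive (wrefl i).
Proof. by case=> A b c; case: i; congr Form => /=; ring. Qed.

Lemma is_root_opp v : is_root v -> is_root (fscale (- 1) v).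
Proof.
case: v => A b c; rewrite /is_root disc_scale /= -[-1 * -1 * _]/(1 * _) Z.mul_1_l.
move=> [|[[dE [k bE]]|[dE [k bE]]]]; [by left|right; left|right; right];
  by split=> //; exists (- k); rewrite bE; ring.
Qed.

(** Otherwise some wall has positive pairing with v; reflecting v in it and changing the sign gives
    a root whose height equals its pairing, hence a multiple of the wall by [negated_root].
    Reflecting back, v itself is such a multiple, of nonzero height. So z0 lies on no mirror. *)
Lemma root_height_neq0 v : is_root v -> height v <> 0.
Proof.
move=> rv h0; have [i i0] := disc_gt0_pairing (is_root_disc_gt0 rv).
have hE := height_wrefl i v; rewrite h0 in hE.
have rv' := is_root_opp (wrefl_root i rv).
have pE : pairing i (fscale (- 1) (wrefl i v)) = pairing i v.
  by clear; case: v => A b c; case: i => /=; ring.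
have := @negated_root i _ rv'; rewrite height_scale pE => /(_ ltac:(lia)).
move=> /(congr1 (wrefl i)); rewrite !wrefl_scale wrefl_wall wreflK.
by move=> /(congr1 height); rewrite !height_scale height_wall; lia.
Qed.

(** * Integer matrices and coset tables *)

Record zmat := Mat { m11 : Z; m12 : Z; m21 : Z; m22 : Z }.

Definition mmul (m n : zmat) : zmat :=
  Mat (m11 m * m11 n + m12 m * m21 n) (m11 m * m12 n + m12 m * m22 n)
      (m21 m * m11 n + m22 m * m21 n) (m21 m * m12 n + m22 m * m22 n).

Definition mdet (m : zmat) : Z := m11 m * m22 m - m12 m * m21 m.

Definition madj (m : zmat) : zmat := Mat (m22 m) (- m12 m) (- m21 m) (m11 m).

Definition zmscale (k : Z) (m : zmat) : zmat :=
  Mat (k * m11 m) (k * m12 m) (k * m21 m) (k * m22 m).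

Definition mat1 : zmat := Mat 1 0 0 1.

Lemma mdet_mul m n : mdet (mmul m n) = mdet m * mdet n.
Proof. by rewrite /mdet /=; ring. Qed.

Lemma mdet_adj m : mdet (madj m) = mdet m.
Proof. by rewrite /mdet /=; ring. Qed.

(** Equality of projective classes, written as the vanishing of all 2 by 2 minors so that the tables
    are checked by computation. *)
Definition proportional (m n : zmat) : bool :=
  (m11 m * m12 n =? m12 m * m11 n) && (m11 m * m21 n =? m21 m * m11 n) &&
  (m11 m * m22 n =? m22 m * m11 n) && (m12 m * m21 n =? m21 m * m12 n) &&
  (m12 m * m22 n =? m22 m * m12 n) && (m21 m * m22 n =? m22 m * m21 n).

Lemma proportionalP m n : proportional m n -> mdet m <> 0 -> mdet n <> 0 ->
  exists k l, [/\ k <> 0, l <> 0 & zmscale k m = zmscale l n].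
Proof.
case: m n => [a b c d] [a' b' c' d']; rewrite /proportional /zmscale /mdet /=.
move=> /andP[/andP[/andP[/andP[/andP[]]]]].
move=> /Z.eqb_spec e1 /Z.eqb_spec e2 /Z.eqb_spec e3.
move=> /Z.eqb_spec e4 /Z.eqb_spec e5 /Z.eqb_spec e6 d0 d0'.
case: (Z.eq_dec a 0) => [a0|a0].
  case: (Z.eq_dec b 0) => [b0|b0]; first by exfalso; apply: d0; rewrite a0 b0; ring.
  exists b', b; split=> //; last by congr Mat; lia.
  move=> b'0; apply: d0'; have : b * a' = 0 by lia.
  by move=> /Z.mul_eq_0 [] // ->; rewrite b'0; ring.
exists a', a; split=> //; last by congr Mat; lia.
move=> a'0; apply: d0'; have : a * b' = 0 by lia.
by move=> /Z.mul_eq_0 [] // ->; rewrite a'0; ring.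
Qed.

(* Primitive integer matrices of the reflections in the walls. *)
Definition side_mat (i : side) : zmat :=
  match i with
  | S0 => Mat 1 0 0 (-1) | S1 => Mat 1 (-1) 0 (-1)
  | S2 => Mat 11 (-5) 22 (-11) | S3 => Mat 23 (-8) 66 (-23)
  | S4 => Mat 10 (-3) 33 (-10) | S5 => Mat 0 1 11 0
  end.

Definition word_mat (w : seq side) : zmat :=
  foldr (fun i m => mmul (side_mat i) m) mat1 w.

Definition side_scale (i : side) : Z :=
  match i with S0 => -1 | S3 => 1 | _ => 2 end.

Lemma side_matE i : zmscale (side_scale i) (side_mat i) =
  Mat (- fb (wall i)) (- (2 * fc (wall i))) (2 * (11 * fa (wall i))) (fb (wall i)).
Proof. by case: i. Qed.

Definition matS : zmat := Mat 0 (-1) 1 0.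
Definition matT : zmat := Mat 1 1 0 1.
Definition matTV : zmat := Mat 1 (-1) 0 1.

(* Representatives of the cosets in PSL2(Z) of its intersection with the hexagon
   group; transition_words lists the elements of that intersection through which
   the generators of PSL2(Z) permute them. *)
Definition modular_reps : seq zmat :=
  [:: Mat 1 0 0 1; Mat 0 1 (-1) 0; Mat 1 (-1) 1 0; Mat 1 1 (-1) 0;
   Mat 2 (-1) 1 0; Mat 2 1 (-1) 0; Mat 1 0 (-2) 1; Mat 3 (-1) 1 0;
   Mat 1 0 2 1; Mat 3 1 (-1) 0; Mat 3 (-1) (-2) 1; Mat 1 0 (-3) 1;
   Mat 3 1 2 1; Mat 1 0 3 1; Mat 2 (-1) 3 (-1); Mat 4 (-1) (-3) 1;
   Mat 2 1 (-3) (-1); Mat 4 1 3 1; Mat 5 (-2) 3 (-1); Mat 5 2 (-3) (-1);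
   Mat 8 (-3) 3 (-1); Mat 8 3 (-3) (-1); Mat 11 (-4) 3 (-1); Mat 3 (-1) (-11) 4].

Lemma modular_reps_det : all (fun m => mdet m =? 1) modular_reps.
Proof. by []. Qed.

Definition transition_words : seq (seq side) :=
  [:: [::]; [:: S0; S1]; [:: S0; S3]; [:: S0; S4]; [:: S1; S0]; [:: S2; S5];
   [:: S3; S0]; [:: S4; S0]; [:: S5; S2]; [:: S0; S2; S0; S5];
   [:: S0; S2; S4; S2]; [:: S0; S5; S2; S0]; [:: S2; S3; S4; S2];
   [:: S2; S4; S2; S0]; [:: S2; S4; S2; S3]].

Definition coset_table_ok (gens reps : seq zmat) (test : zmat -> bool) : bool :=
  all (fun g => all (fun r => has (fun r' =>
    test (mmul (madj r') (mmul g r))) reps) reps) gens.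

Lemma modular_table : coset_table_ok [:: matS; matT; matTV] modular_reps
  (fun m => has (fun w => proportional m (word_mat w)) transition_words).
Proof. by vm_compute. Qed.

Definition all_sides : seq side := [:: S0; S1; S2; S3; S4; S5].

(* Coset representatives, in the other direction, of the intersection with
   PSL2(Z) in the hexagon group. *)
Definition hexagon_reps : seq (seq side) := [:: [::]; [:: S0]; [:: S5]; [:: S5; S0]].

(* A matrix of determinant k^2 divisible by k. *)
Definition unimodular_up_to_scale (m : zmat) : bool :=
  has (fun k => [&& mdet m =? k * k, m11 m mod k =? 0, m12 m mod k =? 0,
                    m21 m mod k =? 0 & m22 m mod k =? 0]) [:: 1; 11].

Lemma unimodular_up_to_scaleP m : unimodular_up_to_scale m ->
  exists k n, [/\ k <> 0, m = zmscale k n & mdet n = 1].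
Proof.
move=> H; have : exists k, k <> 0 /\ [&& mdet m =? k * k, m11 m mod k =? 0,
    m12 m mod k =? 0, m21 m mod k =? 0 & m22 m mod k =? 0].
  by move: H; rewrite /unimodular_up_to_scale /= orbF => /orP[H|H];
    [exists 1|exists 11].
case: m {H} => a b c d [k [k0 /= /and5P[/Z.eqb_spec dE]]].
move=> /Z.eqb_spec /(Z.mod_divide _ _ k0) [a' aE] /Z.eqb_spec /(Z.mod_divide _ _ k0) [b' bE].
move=> /Z.eqb_spec /(Z.mod_divide _ _ k0) [c' cE] /Z.eqb_spec /(Z.mod_divide _ _ k0) [d' d'E].
exists k, (Mat a' b' c' d'); split=> //; first by rewrite /zmscale /=; congr Mat; lia.
rewrite /mdet /= in dE *; apply: (Z.mul_reg_l _ _ (k * k)); first by nia.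
by rewrite Z.mul_1_r -[RHS]dE aE bE cE d'E; ring.
Qed.

(** Up to sign, determinants of words are powers of 11, so modulo squares they are 1, -1, 11 or -11.
    The four representatives realise these classes; the right one leaves a determinant 1 or 121,
    which is why [unimodular_up_to_scale] tries k = 1 and k = 11. *)
Lemma hexagon_table : all (fun i => all (fun v => has (fun v' =>
    unimodular_up_to_scale (word_mat (rev v' ++ i :: v))) hexagon_reps) hexagon_reps)
  all_sides.
Proof. by vm_compute. Qed.

(** * Matching a matrix modulo n by a word in unipotents *)

Lemma coprime_shift (a c n : nat) : (0 < a)%N -> coprime a c -> (0 < n)%N ->
  exists k, coprime (a + c * k)%N n.
Proof.
(* With k the part of n prime to a, a prime p of n divides k exactly when it does not divide a. As c
   is prime to a, p divides exactly one of a and c k, hence not their sum. *)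
move=> a0 ac n0; pose k := (n`_(\pi(a)^'))%N; exists k.
rewrite coprime_sym; apply/negPn/negP => nco.
have g1 : (1 < gcdn n (a + c * k))%N.
  by move: nco; rewrite /coprime neq_ltn ltnNge gcdn_gt0 n0.
have := pdiv_prime g1; set p := pdiv _ => pp.
have := pdiv_dvd (gcdn n (a + c * k)); rewrite -/p dvdn_gcd => /andP[pn pak].
have pk : (p %| k)%N = ~~ (p %| a)%N.
  have : (p \in primes k) = (p \in [seq q <- primes n | q \in \pi(a)^']).
    by rewrite /k primes_part.
  by rewrite mem_filter !mem_primes inE /= inE /= mem_primes pp n0 a0 pn part_gt0 /= andbT.
have [pa|pa] := boolP (p %| a)%N; last first.
  by move: pak; rewrite dvdn_addl ?(negPf pa) // dvdn_mull // pk.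
move: pak; rewrite dvdn_addr // Euclid_dvdM // pk pa orbF => pc.
have : (p %| gcdn a c)%N by rewrite dvdn_gcd pa.
by rewrite (eqP ac) dvdn1 => /eqP p1; move: pp; rewrite p1.
Qed.

(* With a = 23 + 55 K and u an inverse of a modulo N, the product L2 U1 L3 U2
   is congruent to diag (a, u), so that the whole word is congruent to
   [[a, 5 + 12 K], [55, 12]]. *)
Definition congruence_word (K u : Z) : zmat :=
  mmul (mmul (Mat 1 0 (11 * (5 * u)) 1)
    (mmul (mmul (mmul (Mat 1 0 (11 * (- (u * (2 + 5 * K)))) 1) (Mat 1 1 0 1))
      (Mat 1 0 (11 * (2 + 5 * K)) 1)) (Mat 1 (- u) 0 1)))
    (Mat 1 ((5 + 12 * K) * u) 0 1).

Lemma congruence_wordP K N u t : u * (23 + 55 * K) = 1 + N * t ->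
  exists k1 k2 k3 k4,
    mmul (mmul (Mat 1 K 0 1) (Mat 23 5 55 12)) (madj (congruence_word K u)) =
    Mat (1 + N * k1) (N * k2) (N * k3) (1 + N * k4).
Proof.
move=> ut; have Nt : N * t = u * (23 + 55 * K) - 1 by lia.
have dH : mdet (congruence_word K u) = 1 by rewrite !mdet_mul /mdet /=; ring.
(* The entries of the word differ from those of [[a, 5 + 12 K], [55, 12]] by N times these numbers,
   all multiples of the defect t in u a = 1 + N t. *)
pose e12 := t * (4 + 12 * K); pose e21 := t * (33 - 55 * K).
pose e22 := t * (u * (22 + 55 * K) - 55 * u - 1 +
  (5 + 12 * K) * u * (33 - 55 * K) + 12).
have h11 : m11 (congruence_word K u) = 23 + 55 * K by rewrite /=; ring.
have h12 : m12 (congruence_word K u) = 5 + 12 * K + N * e12.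
  by rewrite /e12 Z.mul_assoc Nt /=; ring.
have h21 : m21 (congruence_word K u) = 55 + N * e21.
  by rewrite /e21 Z.mul_assoc Nt /=; ring.
have h22 : m22 (congruence_word K u) = 12 + N * e22.
  by rewrite /e22 Z.mul_assoc Nt /=; ring.
move: dH h11 h12 h21 h22; case: (congruence_word K u) => p q r s.
rewrite /mdet /mmul /madj /= => dH h11 h12 h21 h22.
exists (e12 * r), (- (e12 * p)), (e22 * r - e21 * s), (e21 * q - e22 * p).
have b : 5 + 12 * K = q - N * e12 by lia.
have c : 55 = r - N * e21 by lia.
have d : 12 = s - N * e22 by lia.
congr Mat.
- have -> : 1 * 23 + K * 55 = p by lia.
  have -> : 1 * 5 + K * 12 = q - N * e12 by lia.
  by rewrite -dH; ring.
- have -> : 1 * 23 + K * 55 = p by lia.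
  have -> : 1 * 5 + K * 12 = q - N * e12 by lia.
  by ring.
- have -> : 0 * 23 + 1 * 55 = r - N * e21 by lia.
  have -> : 0 * 5 + 1 * 12 = s - N * e22 by lia.
  by ring.
- have -> : 0 * 23 + 1 * 55 = r - N * e21 by lia.
  have -> : 0 * 5 + 1 * 12 = s - N * e22 by lia.
  by rewrite -dH; ring.
Qed.

(** Euclid's algorithm on the first column: translations reduce the upper entry modulo the lower one
    and [matS] exchanges them, so the absolute value of [m21] decreases until it is 0. *)
Lemma SL2Z_ind (P : zmat -> Prop) : P mat1 -> P (zmscale (-1) mat1) ->
  (forall m, P (mmul matS m) -> P m) -> (forall m, P (mmul matT m) -> P m) ->
  (forall m, P (mmul matTV m) -> P m) -> forall m, mdet m = 1 -> P m.
Proof.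
move=> P1 PN PS PT PTV.
have shift k a b c d : P (Mat (a + k * c) (b + k * d) c d) -> P (Mat a b c d).
  have pos (n : nat) : forall a b,
      P (Mat (a + Z.of_nat n * c) (b + Z.of_nat n * d) c d) -> P (Mat a b c d).
    elim: n => [|n IHn] {}a {}b; first by congr (P (Mat _ _ _ _)); lia.
    move=> H; apply: PT; rewrite /mmul /=.
    have := IHn (a + c) (b + d).
    have -> : a + c + Z.of_nat n * c = a + Z.of_nat n.+1 * c by lia.
    have -> : b + d + Z.of_nat n * d = b + Z.of_nat n.+1 * d by lia.
    by move=> /(_ H); congr (P (Mat _ _ _ _)); lia.
  have neg (n : nat) : forall a b,
      P (Mat (a - Z.of_nat n * c) (b - Z.of_nat n * d) c d) -> P (Mat a b c d).
    elim: n => [|n IHn] {}a {}b; first by congr (P (Mat _ _ _ _)); lia.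
    move=> H; apply: PTV; rewrite /mmul /=.
    have := IHn (a - c) (b - d).
    have -> : a - c - Z.of_nat n * c = a - Z.of_nat n.+1 * c by lia.
    have -> : b - d - Z.of_nat n * d = b - Z.of_nat n.+1 * d by lia.
    by move=> /(_ H); congr (P (Mat _ _ _ _)); lia.
  case: (Z.le_ge_cases 0 k) => k0 H.
    by apply: (pos (Z.to_nat k)); rewrite Z2Nat.id.
  by apply: (neg (Z.to_nat (- k))); move: H; congr (P (Mat _ _ _ _)); rewrite Z2Nat.id; lia.
have main (n : nat) : forall m, mdet m = 1 -> Z.abs (m21 m) < Z.of_nat n -> P m.
  elim: n => [|n IHn] [a b c d]; rewrite /mdet /= => dm cn; first by lia.
  case: (Z.eq_dec c 0) => [c0|c0].
    subst c; have ad : a * d = 1 by lia.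
    have [[-> ->]|[-> ->]] : (a = 1 /\ d = 1) \/ (a = -1 /\ d = -1).
      by case: (Z.mul_eq_1 _ _ ad) => aE; [left|right]; split=> //; lia.
      by apply: (shift (- b)); move: P1; congr (P (Mat _ _ _ _)); lia.
    by apply: (shift b); move: PN; rewrite /zmscale /mat1 /=; congr (P (Mat _ _ _ _)); lia.
  apply: (shift (- (a / c))); apply: PS; apply: IHn; rewrite /mmul /mdet /=; first by lia.
  have := Z.mod_pos_bound a c; have := Z.mod_neg_bound a c; have := Z.div_mod a c c0.
  by lia.
by move=> m dm; apply: (main (Z.to_nat (Z.abs (m21 m) + 1))) => //; lia.
Qed.

(** * Traces of powers *)

Fixpoint zpow (x : Z) (n : nat) : Z := if n is n'.+1 then x * zpow x n' else 1.

Lemma zpowM x y n : zpow (x * y) n = zpow x n * zpow y n.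
Proof. by elim: n => [|n IHn] //=; rewrite IHn; ring. Qed.

Lemma zpow_neq0 x n : x <> 0 -> zpow x n <> 0.
Proof. by move=> x0; elim: n => [|n IHn] //= /Z.mul_eq_0 []. Qed.

Section TraceSequence.
Variables s d : Z.

(* Coefficients of the n-th power of a matrix of trace s and determinant d in
   the basis formed by the matrix and the identity. *)
Fixpoint power_coef (n : nat) : Z * Z :=
  if n is n'.+1 then (s * (power_coef n').1 + (power_coef n').2, - d * (power_coef n').1)
  else (0, 1).

Definition power_trace n := (power_coef n).1 * s + 2 * (power_coef n).2.

Lemma power_traceS n :
  power_trace n.+2 = s * power_trace n.+1 - d * power_trace n.
Proof. by rewrite /power_trace /=; ring. Qed.

(** For M of trace s and determinant d, the determinant of x M + y is x^2 d + x y s + y^2; so both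
    sides are the determinant of the n-th power of M. *)
Lemma power_coef_norm n :
  (power_coef n).1 * (power_coef n).1 * d + (power_coef n).1 * (power_coef n).2 * s +
  (power_coef n).2 * (power_coef n).2 = zpow d n.
Proof. by elim: n => [|n IHn] /=; [ring|rewrite -IHn; ring]. Qed.

End TraceSequence.

(* If the trace of the n-th power of M^2 / det M is an integer, then so is
   (tr M)^2 / det M: a rational root of a monic integer polynomial is an
   integer. *)
Lemma power_trace_dvd t d T n : 0 < d -> (0 < n)%N ->
  power_trace (t * t - 2 * d) (d * d) n * power_trace (t * t - 2 * d) (d * d) n =
    zpow (d * d) n * (T * T) -> (d | t * t).
Proof.
move=> d0 n0; set g := Z.gcd (t * t) d.
have g0 : g <> 0 by move=> /Z.gcd_eq_0_r; lia.
have [v vE] : (g | t * t) by exact: Z.gcd_divide_l.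
have [q qE] : (g | d) by exact: Z.gcd_divide_r.
have cop : Z.gcd v q = 1.
  have := Z.gcd_div_gcd (t * t) d g g0 erefl.
  by rewrite {1}vE {1}qE !Z.div_mul.
clearbody g; rewrite vE qE => E.
(* v / q is t^2 / d in lowest terms, and e is the trace sequence with the factor g removed. Modulo q
   it reduces to the powers of v, while the hypothesis makes e n equal to T q^n up to sign. Hence q
   divides a power of v, and coprimality leaves only a unit. *)
pose e := power_trace (v - 2 * q) (q * q).
have eE m : power_trace (v * g - 2 * (q * g)) (q * g * (q * g)) m = zpow g m * e m.
  have [] : power_trace (v * g - 2 * (q * g)) (q * g * (q * g)) m = zpow g m * e m /\
    power_trace (v * g - 2 * (q * g)) (q * g * (q * g)) m.+1 = zpow g m.+1 * e m.+1.
    elim: m => [|m [IH1 IH2]]; first by rewrite /e /power_trace /=; split; ring.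
    by split=> //; rewrite power_traceS IH1 IH2 /e power_traceS /=; ring.
  by [].
have eM m : (q | e m.+1 - zpow v m.+1).
  have [] : (q | e m.+1 - zpow v m.+1) /\ (q | e m.+2 - zpow v m.+2).
    elim: m => [|m [IH1 IH2]].
      split; rewrite /e /power_trace /=.
        by exists (- 2); ring.
      by exists (2 * q - 4 * v); ring.
    split=> //; rewrite /e power_traceS -/(e _) -/(e _).
    move: IH2 => [k kE]; exists (v * k - 2 * e m.+2 - q * e m.+1).
    have -> : e m.+2 = k * q + zpow v m.+2 by lia.
    by rewrite /=; ring.
  by [].
have gn0 := @zpow_neq0 g n g0.
move: E; rewrite eE => E.
have {E} : (e n - zpow q n * T) * (e n + zpow q n * T) = 0.
  apply: (Z.mul_reg_l _ _ (zpow g n * zpow g n)); first by nia.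
  by move: E; rewrite !zpowM => E; ring_simplify; ring_simplify in E; lia.
have qT : (q | zpow q n * T).
  by case: n n0 {gn0} => // m _ /=; exists (zpow q m * T); ring.
have {qT} qe : (e n - zpow q n * T) * (e n + zpow q n * T) = 0 -> (q | e n).
  move=> /Z.mul_eq_0 [] H.
    by have -> : e n = zpow q n * T by lia.
  have -> : e n = - (zpow q n * T) by lia.
  exact/Z.divide_opp_r.
move=> /qe {}qe; case: n n0 gn0 qe => // n _ _ qe.
have : (q | zpow v n.+1).
  have -> : zpow v n.+1 = e n.+1 - (e n.+1 - zpow v n.+1) by ring.
  exact: Z.divide_sub_r.
elim: n.+1 => [|m IHm] /=; last first.
  by move=> /Z.gauss; rewrite Z.gcd_comm => /(_ cop).
move=> [k kE]; exists (v * k).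
have -> : v * k * (q * g) = v * (k * q) * g by ring.
by rewrite -kE; ring.
Qed.

(** * Primitive forms and their discriminants *)

Lemma zdvdE (p : nat) x : (Z.of_nat p | x) <-> (p %| Z.abs_nat x)%N.
Proof.
split=> [[k ->]|/dvdnP[k kE]].
  by rewrite Zabs2Nat.inj_mul Zabs2Nat.id multE dvdn_mull.
apply/Z.divide_abs_r; exists (Z.of_nat k).
by rewrite -Nat2Z.inj_mul multE -kE Zabs2Nat.id_abs.
Qed.

Lemma zprimeM (p : nat) x y : prime p -> (Z.of_nat p | x * y) ->
  (Z.of_nat p | x) \/ (Z.of_nat p | y).
Proof.
move=> pp; rewrite !zdvdE Zabs2Nat.inj_mul multE Euclid_dvdM // => /orP[]; by [left|right].
Qed.

Lemma zprimeX (p : nat) x : prime p -> (Z.of_nat p | x * x) -> (Z.of_nat p | x).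
Proof. by move=> pp /(zprimeM pp) []. Qed.

Lemma zprime_prime (p q : nat) : prime p -> prime q -> (Z.of_nat p | Z.of_nat q) -> p = q.
Proof. by move=> pp pq; rewrite zdvdE Zabs2Nat.id dvdn_prime2 // => /eqP. Qed.

Definition primitive (a b c : Z) : Prop :=
  forall p : nat, prime p ->
    ~ [/\ (Z.of_nat p | a), (Z.of_nat p | b) & (Z.of_nat p | c)].

Lemma primitive_multiple a b c : ~ (a = 0 /\ b = 0 /\ c = 0) ->
  exists g a' b' c', [/\ g <> 0, a = g * a', b = g * b', c = g * c' & primitive a' b' c'].
Proof.
move=> nz; pose g := Z.gcd a (Z.gcd b c).
have g0 : g <> 0.
  move=> g0; apply: nz; have := Z.gcd_eq_0_l _ _ g0; have := Z.gcd_eq_0_r _ _ g0.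
  by move=> g1; have := Z.gcd_eq_0_l _ _ g1; have := Z.gcd_eq_0_r _ _ g1; lia.
have [a' aE] : (g | a) by exact: Z.gcd_divide_l.
have gbc : (g | Z.gcd b c) by exact: Z.gcd_divide_r.
have [b' bE] : (g | b) by apply: Z.divide_trans gbc (Z.gcd_divide_l _ _).
have [c' cE] : (g | c) by apply: Z.divide_trans gbc (Z.gcd_divide_r _ _).
exists g, a', b', c'; split; try lia.
move=> p pp [[x xE] [y yE] [z zE]].
have [k kE] : (Z.of_nat p * g | g).
  by apply: Z.gcd_greatest; [|apply: Z.gcd_greatest];
    [exists x|exists y|exists z]; rewrite ?aE ?bE ?cE ?xE ?yE ?zE; ring.
have : k * Z.of_nat p = 1 by apply: (Z.mul_reg_r _ _ g g0); lia.
by rewrite Z.mul_comm => /Z.mul_eq_1; have /ltP := prime_gt1 pp; lia.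
Qed.

(** Local at each prime p dividing D. If p is neither 2 nor 11, the divisibilities give p | b, then
    p | A, then p | c, against primitivity. At 2 and 11 the factors 4 and 44 absorb some
    divisibility, and the same contradiction appears only when 8, respectively 121, divides D. *)
Lemma disc_dvd44 A b c D : primitive (11 * A) b c ->
  D = b * b - 44 * A * c -> 0 < D -> (D | 4 * (b * b)) ->
  (D | 4 * ((11 * A + b) * (11 * A + b))) -> (D | 44 * ((A - c) * (A - c))) ->
  (D | 44).
Proof.
move=> prim DE D0 [k1 E1] [k2 E2] [k3 E3].
have DN : Z.of_nat (Z.abs_nat D) = D by rewrite Zabs2Nat.id_abs; lia.
have n0 : (0 < Z.abs_nat D)%N by apply/ltP; lia.
rewrite -DN; apply/zdvdE; apply/dvdn_partP => // p.
rewrite mem_primes => /and3P[pp _ /zdvdE [d dE]].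
have p4 x k : 4 * (x * x) = k * D -> p != 2%N -> (Z.of_nat p | x).
  move=> xE p2; apply: zprimeX => //.
  have [||//] := @zprimeM p 4 (x * x) pp.
    by exists (k * d); rewrite xE dE; ring.
  have -> : 4 = Z.of_nat 2 * Z.of_nat 2 by [].
  by move=> /(zprimeX pp) /(zprime_prime pp (isT : prime 2)) /eqP; rewrite (negPf p2).
have bound m : ~ (Z.of_nat (p ^ m.+1) | D) -> (p ^ m %| 44)%N ->
    ((Z.abs_nat D)`_p %| 44)%N.
  rewrite zdvdE => /negP; rewrite pfactor_dvdn // -ltnNge ltnS => le d44.
  by rewrite p_part; apply: dvdn_trans d44; apply: dvdn_exp2l.
have [p2|p2] := eqVneq p 2%N.
  apply: (@bound 2%N); last by rewrite p2.
  rewrite p2 => -[e eE]; rewrite -[Z.of_nat _]/8 in eE; clear - prim DE E1 E2 E3 eE.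
  apply: (prim 2%N isT).
  have [x xE] : (Z.of_nat 2 | b).
    by apply: zprimeX => //; exists (k1 * e); rewrite -[Z.of_nat 2]/2; lia.
  have [y yE] : (Z.of_nat 2 | 11 * A + b).
    by apply: zprimeX => //; exists (k2 * e); rewrite -[Z.of_nat 2]/2; lia.
  have [z zE] : (Z.of_nat 2 | A - c).
    apply: zprimeX => //.
    have [||//] := @zprimeM 2 11 ((A - c) * (A - c)) isT.
      by exists (k3 * e); rewrite -[Z.of_nat 2]/2; lia.
    by move=> [k]; rewrite -[Z.of_nat 2]/2; lia.
  rewrite -[Z.of_nat 2]/2 in xE yE zE *.
  by split; [exists (y - x)|exists x|exists (y - x - 5 * A - z)]; lia.
have [x xE] := p4 _ _ E1 p2; have [y yE] := p4 _ _ E2 p2.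
have pa : (Z.of_nat p | 11 * A) by exists (y - x); lia.
have [p11|p11] := eqVneq p 11%N.
  apply: (@bound 1%N); last by rewrite p11.
  rewrite p11 => -[e eE]; rewrite -[Z.of_nat _]/121 in eE.
  rewrite p11 -[Z.of_nat _]/11 in xE; clear - prim DE E3 eE xE.
  have p4' w : (11 | 4 * w) -> (11 | w) by move=> [k kE]; exists (3 * k - w); lia.
  have [y yE] : (11 | A - c).
    by apply: (@zprimeX 11) => //; apply: p4'; exists (k3 * e); lia.
  have Ac11 : (Z.of_nat 11 | A * c).
    apply: p4'; exists (x * x - e).
    have : 44 * A * c = b * b - D by lia.
    by rewrite eE xE; lia.
  apply: (prim 11%N isT); rewrite -[Z.of_nat 11]/11; split.
  - by exists A; ring.
  - by exists x.
  by case: (zprimeM (isT : prime 11) Ac11) => [[z zE]|//];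
    rewrite -[Z.of_nat 11]/11 in zE; exists (z - y); lia.
exfalso; apply: (prim p pp); split=> //; first by exists x.
have pA : (Z.of_nat p | A).
  by have [/(zprime_prime pp (isT : prime 11)) /eqP|//] := zprimeM pp pa; rewrite (negPf p11).
have : (Z.of_nat p | A - c).
  apply: zprimeX => //.
  have [||//] := @zprimeM p 44 ((A - c) * (A - c)) pp.
    by exists (k3 * d); rewrite E3 dE; ring.
  have -> : 44 = Z.of_nat 2 * (Z.of_nat 2 * Z.of_nat 11) by [].
  move=> /(zprimeM pp) [/(zprime_prime pp (isT : prime 2)) /eqP|/(zprimeM pp) []].
  - by rewrite (negPf p2).
  - by move=> /(zprime_prime pp (isT : prime 2)) /eqP; rewrite (negPf p2).
  - by move=> /(zprime_prime pp (isT : prime 11)) /eqP; rewrite (negPf p11).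
by move: pA => [u uE] [w wE]; exists (u - w); lia.
Qed.

(** The three divisibilities say that (tr)^2 / det is an integer for the products of the reflection
    with those in [S0], [S1] and [S5]. The last has the extra factor 11 of the determinant of
    [side_mat S5], which makes a divisible by 11. Among the divisors of 44, only 1, 4 and 44 are 0
    or 1 modulo 4, as a discriminant must be. *)
Lemma root_conditions a b c D : primitive a b c ->
  D = b * b - 4 * a * c -> 0 < D -> (D | 2 * b * (2 * b)) ->
  (D | 2 * (a + b) * (2 * (a + b))) -> (11 * D | (2 * a - 22 * c) * (2 * a - 22 * c)) ->
  exists2 A, a = 11 * A & is_root (Form A b c).
Proof.
move=> prim DE D0 [k1 E1] [k2 E2] [k3 E3].
have [A aE] : (Z.of_nat 11 | a).
  have [k kE] : (Z.of_nat 11 | 2 * a - 22 * c).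
    by apply: zprimeX => //; exists (k3 * D); rewrite E3 -[Z.of_nat 11]/11; ring.
  by rewrite -[Z.of_nat 11]/11 in kE *; exists (6 * k + 12 * c - a); lia.
rewrite -[Z.of_nat 11]/11 in aE; have {}aE : a = 11 * A by lia.
exists A => //; subst a.
have D44 : (D | 44).
  apply: (@disc_dvd44 A b c) => //; first by rewrite DE; ring.
  - by exists k1; rewrite -E1; ring.
  - by exists k2; rewrite -E2; ring.
  by exists k3; lia.
have [q qE] := D44.
have dE : disc (Form A b c) = D by rewrite /disc /= DE; ring.
have Dlist : D = 1 \/ D = 2 \/ D = 4 \/ D = 11 \/ D = 22 \/ D = 44.
  have q0 : 0 < q by nia.
  have : D <= 44 by nia.
  move=> D44'; have [n nE] : exists n, D = Z.of_nat n by exists (Z.to_nat D); lia.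
  have : (n <= 44)%N by apply/leP; lia.
  move: nE qE; clear; move=> -> qE n44.
  by do 45 (case: n n44 qE => [|n] n44 qE; first by lia).
have par : (exists k, b = 2 * k) \/ (exists k, b = 2 * k + 1).
  by case: (Z.Even_or_Odd b) => -[k kE]; [left|right]; exists k.
have mod4 : exists k, D = 4 * k \/ D = 4 * k + 1.
  case: par => -[k kE].
    by exists (k * k - 11 * A * c); left; rewrite DE kE; ring.
  by exists (k * k + k - 11 * A * c); right; rewrite DE kE; ring.
move: mod4 => [k mod4].
have even4 : D = 4 \/ D = 44 -> exists k, b = 2 * k.
  move=> D4; case: par => // -[x xE]; exfalso.
  have : (2 * x + 1) * (2 * x + 1) = D + 44 * A * c.
    by rewrite -xE; lia.
  by lia.
rewrite /is_root dE /=.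
case: Dlist => [|[|[|[|[|]]]]] D1; try by (exfalso; lia).
- by left.
- by right; left; split=> //; apply: even4; left.
right; right; split=> //; have [x xE] := even4 (or_intror D1).
have [y yE] : (Z.of_nat 11 | b).
  by apply: zprimeX => //; exists (4 + 4 * A * c); rewrite -[Z.of_nat 11]/11; lia.
rewrite -[Z.of_nat 11]/11 in yE; exists (6 * y - x); lia.
Qed.

End IntegerArithmetic.

Require Import Defs.
From mathcomp Require Import all_boot all_order all_algebra.
From mathcomp Require Import complex.
From mathcomp Require Import all_classical all_reals all_analysis.
From mathcomp Require Import measurable_realfun ssrZ ring lra.

Import Order.TTheory GRing.Theory Num.Theory.
Import numFieldNormedType.Exports.

Local Open Scope classical_set_scope.
Local Open Scope ring_scope.
Local Open Scope complex_scope.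

Lemma det_mx2 (T : comNzRingType) (A : 'M[T]_2) :
  \det A = A 0 0 * A 1 1 - A 0 1 * A 1 0.
Proof.
rewrite (expand_det_row _ 0) big_ord_recl big_ord1 /cofactor !det_mx11.
rewrite !mxE /= expr0 mul1r expr1 mulN1r mulrN.
by congr (A _ _ * A _ _ - A _ _ * A _ _); exact/val_inj.
Qed.

(** * Isometries as real matrices up to scale *)

Section Representation.
Variable R : realType.
Implicit Types (g h : isom R) (z w : uhp R).

Definition den (r s : R) z : R := (r * xc z + s) ^+ 2 + (r * yc z) ^+ 2.

(* In coordinates the same formulas serve both orientations: a matrix of
   negative determinant acts as the Moebius map of the conjugate of z. *)
Definition represents (p q r s : R) g : Prop :=
  p * s - q * r != 0 /\ forall z,
    xc (g z) * den r s z = (p * xc z + q) * (r * xc z + s) + p * r * yc z ^+ 2 /\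
    yc (g z) * den r s z = `|p * s - q * r| * yc z.

Lemma den_gt0 p q r s z : p * s - q * r != 0 -> 0 < den r s z.
Proof. by move=> d0; apply: (mobius_den_gt0 _ d0); rewrite gt_eqF ?yc_gt0. Qed.

Lemma uhp_eq z w : xc z = xc w -> yc z = yc w -> z = w.
Proof. by move=> ex ey; apply: coords_inj; rewrite /coords ex ey. Qed.

Lemma represents_eq p q r s g h :
  represents p q r s g -> represents p q r s h -> g = h.
Proof.
move=> [d0 gE] [_ hE]; apply: isom_ext => z.
have N0 := lt0r_neq0 (den_gt0 z d0).
have [gx gy] := gE z; have [hx hy] := hE z.
by apply: uhp_eq; apply: (mulIf N0); rewrite ?gx ?hx ?gy ?hy.
Qed.

Lemma represents1 : represents 1 0 0 1 1%g.
Proof.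
split=> [|z]; first by rewrite mulr1 mulr0 subr0 oner_neq0.
have -> : 1 * 1 - 0 * 0 = 1 :> R by ring.
by rewrite isom1E /den normr1; split; ring.
Qed.

Lemma represents_scale k p q r s g : k != 0 ->
  represents (k * p) (k * q) (k * r) (k * s) g <-> represents p q r s g.
Proof.
move=> k0.
have dE : k * p * (k * s) - k * q * (k * r) = k ^+ 2 * (p * s - q * r) by ring.
have NE z : den (k * r) (k * s) z = k ^+ 2 * den r s z by rewrite /den; ring.
have k20 : k ^+ 2 != 0 by rewrite expf_neq0.
rewrite /represents dE mulf_eq0 (negPf k20) /=.
split=> -[d0 gE]; split=> // z; have [gx gy] := gE z; rewrite ?NE in gx gy *.
  rewrite normrM normrX real_normK ?num_real // in gy.
  by split; apply: (mulfI k20); rewrite [LHS]mulrCA ?gx ?gy; ring.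
rewrite normrM normrX real_normK ?num_real // .
by split; rewrite mulrCA ?gx ?gy; ring.
Qed.

Lemma represents_mul p q r s p' q' r' s' g h :
  represents p q r s g -> represents p' q' r' s' h ->
  represents (p * p' + q * r') (p * q' + q * s')
             (r * p' + s * r') (r * q' + s * s') (g * h)%g.
Proof.
move=> [d0 gE] [d0' hE].
have dE : (p * p' + q * r') * (r * q' + s * s') -
  (p * q' + q * s') * (r * p' + s * r') = (p * s - q * r) * (p' * s' - q' * r').
  by ring.
split=> [|z]; first by rewrite dE mulf_neq0.
rewrite isomME dE normrM.
have [hx hy] := hE z; have [gx gy] := gE (h z).
have N0 := den_gt0 z d0'; have M0 := den_gt0 (h z) d0.
have nK : `|p' * s' - q' * r'| ^+ 2 = (p' * s' - q' * r') ^+ 2.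
  by rewrite real_normK ?num_real.
have XE : xc (h z) =
    ((p' * xc z + q') * (r' * xc z + s') + p' * r' * yc z ^+ 2) / den r' s' z.
  by rewrite -hx mulfK ?gt_eqF.
have YE : yc (h z) = `|p' * s' - q' * r'| * yc z / den r' s' z.
  by rewrite -hy mulfK ?gt_eqF.
have Y2E : yc (h z) ^+ 2 =
    (p' * s' - q' * r') ^+ 2 * yc z ^+ 2 / den r' s' z ^+ 2.
  by rewrite YE !exprMn nK exprVn.
have ME : den r s (h z) =
    den (r * p' + s * r') (r * q' + s * s') z / den r' s' z.
  rewrite {1}/den exprMn Y2E XE; move: N0; rewrite /den => N0; field.
  by rewrite gt_eqF.
rewrite ME in gx gy M0.
split.
  move: gx => /(congr1 ( *%R^~ (den r' s' z))); rewrite -mulrA divfK ?gt_eqF // => ->.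
  rewrite Y2E XE; move: N0; rewrite /den => N0; field.
  by rewrite gt_eqF.
move: gy => /(congr1 ( *%R^~ (den r' s' z))); rewrite -mulrA divfK ?gt_eqF // => ->.
by rewrite YE; field; rewrite gt_eqF.
Qed.

Lemma represents_inv p q r s g :
  represents p q r s g -> represents s (- q) (- r) p g^-1%g.
Proof.
move=> [d0 gE].
have dE : s * p - - q * - r = p * s - q * r by ring.
split=> [|w]; first by rewrite dE.
rewrite dE.
have -> : w = g (g^-1%g w) by rewrite -isomME mulgV isom1E.
set z := g^-1%g w.
have -> : g^-1%g (g z) = z by rewrite -isomME mulVg isom1E.
have [gx gy] := gE z; have N0 := den_gt0 z d0.
have n2 : `|p * s - q * r| ^+ 2 = (p * s - q * r) ^+ 2.
  by rewrite real_normK ?num_real.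
have XE : xc (g z) =
    ((p * xc z + q) * (r * xc z + s) + p * r * yc z ^+ 2) / den r s z.
  by rewrite -gx mulfK ?gt_eqF.
have YE : yc (g z) = `|p * s - q * r| * yc z / den r s z.
  by rewrite -gy mulfK ?gt_eqF.
have Y2E : yc (g z) ^+ 2 = (p * s - q * r) ^+ 2 * yc z ^+ 2 / den r s z ^+ 2.
  by rewrite YE !exprMn n2 exprVn.
have ME : den (- r) p (g z) = (p * s - q * r) ^+ 2 / den r s z.
  by rewrite {1}/den exprMn Y2E XE /den; field; rewrite gt_eqF.
split; last first.
  by rewrite ME YE -n2; field; rewrite gt_eqF.
by rewrite ME Y2E XE /den; field; rewrite gt_eqF.
Qed.

Lemma represents_reflection (l : hform R) :
  represents (- qb l) (- (2 * qc l)) (2 * qa l) (qb l) (reflection l).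
Proof.
have D0 := disc_gt0 l.
have d0 : - qb l * qb l - - (2 * qc l) * (2 * qa l) != 0.
  by rewrite reflection_det oppr_eq0 gt_eqF.
split=> // z; have N0 := den_gt0 z d0.
have zE : zval (reflection l z) = reflection_val l (zval z) by [].
rewrite /xc /yc zE.
move: N0; rewrite /den /xc /yc /reflection_val; case: (zval z) => x y N0.
have -> : conjc (x +i* y) = x +i* (- y) by [].
rewrite /= in N0.
have yN0 : (2 * qa l * x + qb l) ^+ 2 + (2 * qa l * - y) ^+ 2 != 0.
  by rewrite mulrN sqrrN gt_eqF.
rewrite mobius_coords // reflection_det normrN gtr0_norm //= mulrNN.
by rewrite (mulrN _ y) !sqrrN !divfK ?gt_eqF.
Qed.

Lemma represents_acts_as (A : 'M[int]_2) g : \det A = 1 -> acts_as A g ->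
  represents (A 0 0)%:~R (A 0 1)%:~R (A 1 0)%:~R (A 1 1)%:~R g.
Proof.
move=> dA; have {}dA : A 0 0 * A 1 1 - A 0 1 * A 1 0 = 1.
  by rewrite -dA det_mx2.
have dR : (A 0 0)%:~R * (A 1 1)%:~R - (A 0 1)%:~R * (A 1 0)%:~R = 1 :> R.
  by rewrite -!intrM -intrB dA.
move=> gE; split=> [|z]; first by rewrite dR oner_neq0.
have d0 : (A 0 0)%:~R * (A 1 1)%:~R - (A 0 1)%:~R * (A 1 0)%:~R != 0 :> R.
  by rewrite dR oner_neq0.
have := den_gt0 z d0; rewrite dR normr1 mul1r /xc /yc gE /den /xc /yc.
rewrite -!(rmorph_int (real_complex R)); case: (zval z) => x y N0.
by rewrite mobius_coords ?gt_eqF //= dR mul1r !divfK ?gt_eqF.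
Qed.

Lemma acts_as_represents (A : 'M[int]_2) g : \det A = 1 ->
  represents (A 0 0)%:~R (A 0 1)%:~R (A 1 0)%:~R (A 1 1)%:~R g -> acts_as A g.
Proof.
move=> dA gA; have [h hA] := acts_as_exists R dA.
by rewrite (represents_eq gA (represents_acts_as dA hA)).
Qed.

End Representation.

Lemma int_of_ZD x y : int_of_Z (Z.add x y) = int_of_Z x + int_of_Z y.
Proof. exact: (rmorphD int_of_Z). Qed.

Lemma int_of_ZM x y : int_of_Z (Z.mul x y) = int_of_Z x * int_of_Z y.
Proof. exact: (rmorphM int_of_Z). Qed.

Lemma int_of_ZB x y : int_of_Z (Z.sub x y) = int_of_Z x - int_of_Z y.
Proof. exact: (rmorphB int_of_Z). Qed.

Section Cast.
Variable R : realType.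

Definition zr (z : Z) : R := (int_of_Z z)%:~R.

Lemma zrD x y : zr (Z.add x y) = zr x + zr y.
Proof. by rewrite /zr int_of_ZD intrD. Qed.
Lemma zrM x y : zr (Z.mul x y) = zr x * zr y.
Proof. by rewrite /zr int_of_ZM intrM. Qed.
Lemma zrN x : zr (Z.opp x) = - zr x.
Proof. by rewrite /zr -mulrNz; congr intmul; exact: (rmorphN int_of_Z). Qed.
Lemma zrB x y : zr (Z.sub x y) = zr x - zr y.
Proof. by rewrite -Z.add_opp_r zrD zrN. Qed.
Lemma zr_inj : injective zr.
Proof. by move=> x y /intr_inj /(can_inj int_of_ZK). Qed.
Lemma zr_gt0 x : (0 < zr x) = (Z.ltb 0 x).
Proof.
rewrite /zr ltr0z; case: x => //= p.
by have := Pos2Nat.is_pos p; case: (Pos.to_nat p) => //; lia.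
Qed.

Lemma zrNeg p : zr (Z.neg p) = - zr (Z.pos p).
Proof. exact: (zrN (Z.pos p)). Qed.
Lemma zr_const : ((zr 0 = 0) * (zr 1 = 1) * (zr 2 = 2) * (zr 3 = 3) *
  (zr 4 = 4) * (zr 5 = 5) * (zr 10 = 10) * (zr 11 = 11) * (zr 20 = 20) *
  (zr 22 = 22) * (zr 23 = 23) * (zr 33 = 33) * (zr 44 = 44) * (zr 46 = 46) *
  (zr 132 = 132) * (zr 176 = 176))%type.
Proof. by []. Qed.

Definition zrE := (zrD, zrM, zrB, zrN).

End Cast.

(** * Forms as functions on the hyperbolic plane *)

Section Values.
Variable R : realType.
Implicit Types (g h : isom R) (z w : uhp R).

Definition pt (x y : R) (y0 : 0 < y) : uhp R := @Uhp R (x +i* y) y0.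

(** Division by Im z turns the form into a function whose pullback by an isometry is again of this
    kind: the automorphy denominator cancels. Functions of this kind replace matrices in comparing
    isometries. *)
Definition fv (a b c : R) z : R :=
  (a * (xc z ^+ 2 + yc z ^+ 2) + b * xc z + c) / yc z.

Lemma fv_scale t a b c z : fv (t * a) (t * b) (t * c) z = t * fv a b c z.
Proof. by rewrite /fv; ring. Qed.

Lemma fv_eq z w : (forall b c, fv 0 b c z = fv 0 b c w) -> z = w.
Proof.
move=> E; have := E 0 1; have := E 1 0.
rewrite /fv !mul0r !add0r !addr0 !mul1r => ex /(can_inj invrK).
by move=> ey; apply: uhp_eq => //; move: ex; rewrite ey => /mulIf; apply;
  rewrite invr_eq0 gt_eqF ?yc_gt0.
Qed.

Lemma fv_inj a b c a' b' c' : (forall z, fv a b c z = fv a' b' c' z) ->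
  [/\ a = a', b = b' & c = c'].
Proof.
move=> E; have := E (pt 0 (@ltr01 R)); have := E (pt 0 (@ltr0n R 2)).
have := E (pt 1 (@ltr01 R)).
rewrite /fv /xc /yc /= !divr1 => e1 e2 e3.
have {}e2 : 4 * a + c = 4 * a' + c' by move: e2; lra.
by split; move: e1 e2 e3; lra.
Qed.

Lemma fv_represents p q r s g a b c z : represents p q r s g ->
  fv a b c (g z) = fv (a * p ^+ 2 + b * p * r + c * r ^+ 2)
    (2 * a * p * q + b * (p * s + q * r) + 2 * c * r * s)
    (a * q ^+ 2 + b * q * s + c * s ^+ 2) z / `|p * s - q * r|.
Proof.
move=> [d0 gE]; have [gx gy] := gE z; have N0 := den_gt0 z d0.
have y0 := yc_gt0 z.
have nK : `|p * s - q * r| ^+ 2 = (p * s - q * r) ^+ 2.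
  by rewrite real_normK ?num_real.
have n0 : 0 < `|p * s - q * r| by rewrite normr_gt0.
have XE : xc (g z) =
    ((p * xc z + q) * (r * xc z + s) + p * r * yc z ^+ 2) / den r s z.
  by rewrite -gx mulfK ?gt_eqF.
have YE : yc (g z) = `|p * s - q * r| * yc z / den r s z.
  by rewrite -gy mulfK ?gt_eqF.
have Y2E : yc (g z) ^+ 2 = (p * s - q * r) ^+ 2 * yc z ^+ 2 / den r s z ^+ 2.
  by rewrite YE !exprMn nK exprVn.
rewrite /fv Y2E XE YE; move: N0 n0; set n := `|_|; rewrite /den => N0 n0; field.
by rewrite !gt_eqF.
Qed.

(* Stated through values, so that no matrix of g has to be known. *)
Lemma reflection_conj (l l' : hform R) t g p q r s :
  represents p q r s g -> t != 0 ->
  (forall z, fv (qa l') (qb l') (qc l') z = t * fv (qa l) (qb l) (qc l) (g z)) ->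
  reflection l' = (g^-1 * reflection l * g)%g.
Proof.
move=> gE t0 E; have [d0 _] := gE.
have [] := @fv_inj (qa l') (qb l') (qc l')
  (t / `|p * s - q * r| * (qa l * p ^+ 2 + qb l * p * r + qc l * r ^+ 2))
  (t / `|p * s - q * r| *
    (2 * qa l * p * q + qb l * (p * s + q * r) + 2 * qc l * r * s))
  (t / `|p * s - q * r| * (qa l * q ^+ 2 + qb l * q * s + qc l * s ^+ 2)).
  by move=> z; rewrite E (fv_represents _ _ _ _ gE) fv_scale; ring.
set k := t / _ => eA eB eC.
have k0 : k != 0 by rewrite mulf_neq0 // invr_eq0 normr_eq0.
apply: (represents_eq (represents_reflection l')).
have H := represents_mul (represents_mul (represents_inv gE) (represents_reflection l)) gE.
move/(represents_scale _ _ _ _ _ k0): H; rewrite eA eB eC.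
by congr represents; ring.
Qed.

Lemma reflection_scale (l l' : hform R) t : t != 0 -> qa l' = t * qa l ->
  qb l' = t * qb l -> qc l' = t * qc l -> reflection l' = reflection l.
Proof.
move=> t0 eA eB eC; rewrite (@reflection_conj l l' t _ _ _ _ _ (@represents1 R) t0).
  by rewrite invg1 mul1g mulg1.
by move=> z; rewrite eA eB eC fv_scale.
Qed.

End Values.

(** * The group generated by the wall reflections *)

Section Hexagon.
Variable R : realType.
Notation isom := (isom R).
Notation zr := (@zr R).
Implicit Types (g h : isom) (z : uhp R) (v : iform) (i j : side) (w : seq side).

Definition fval v z : R := fv (11 * zr (fa v)) (zr (fb v)) (zr (fc v)) z.

Lemma zr_disc v : zr (disc v) = zr (fb v) ^+ 2 - 4 * (11 * zr (fa v)) * zr (fc v).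
Proof. by rewrite /disc !zrE zr_const; ring. Qed.

Lemma disc_hform v : Z.lt 0 (disc v) -> 0 < zr (fb v) ^+ 2 - 4 * (11 * zr (fa v)) * zr (fc v).
Proof. by move=> /Z.ltb_lt D0; rewrite -zr_disc zr_gt0. Qed.

Definition hform_of v (D0 : Z.lt 0 (disc v)) : hform R := HForm (disc_hform D0).

Definition hwall i : hform R := hform_of (disc_wall_gt0 i).

Definition sg i : isom := reflection (hwall i).

Lemma sgK i : (sg i * sg i = 1)%g.
Proof. by apply: isom_ext => z; rewrite isomME isom1E; apply: reflection_funK. Qed.

Lemma sgV i : (sg i)^-1%g = sg i.
Proof. by apply: (mulgI (sg i)); rewrite mulgV sgK. Qed.

Lemma fval_sg i v z : fval v (sg i z) = fval (wrefl i v) z.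
Proof.
rewrite /fval (fv_represents _ _ _ _ (represents_reflection (hwall i))).
rewrite reflection_det normrN gtr0_norm ?disc_gt0 //.
rewrite mulrC -fv_scale; case: v => A b c.
by case: i => /=; rewrite !zrE ?zrNeg !zr_const; congr fv; field.
Qed.

Definition gw w : isom := foldr (fun i g => sg i * g)%g 1%g w.

Lemma gw_cons i w : gw (i :: w) = (sg i * gw w)%g. Proof. by []. Qed.

Lemma gw_cat w w' : gw (w ++ w') = (gw w * gw w')%g.
Proof. by elim: w => [|i w IHw] /=; rewrite ?mul1g // IHw mulgA. Qed.

Lemma gw_rev w : gw (rev w) = (gw w)^-1%g.
Proof.
elim: w => [|i w IHw] /=; first by rewrite invg1.
by rewrite rev_cons -cats1 gw_cat IHw /= mulg1 invgM sgV.
Qed.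

(** Pulling back reverses composition, hence the left fold in [act] against the right fold in
    [gw]. *)
Lemma fval_gw v w z : fval v (gw w z) = fval (act v w) z.
Proof. by elim: w v => // i w IHw v; rewrite gw_cons isomME fval_sg IHw. Qed.

Lemma gw_represents w : exists p q r s, represents p q r s (gw w).
Proof.
elim: w => [|i w [p [q [r [s H]]]]]; first by do 4 eexists; exact: represents1.
by do 4 eexists; exact: (represents_mul (represents_reflection _) H).
Qed.

Definition z0 : uhp R.
Proof.
by apply: (@pt R (3%:R^-1) (Num.sqrt 11%:R / 33%:R)); rewrite divr_gt0 ?sqrtr_gt0.
Defined.

Lemma xc_z0 : xc z0 = 3%:R^-1. Proof. by []. Qed.

Lemma norm_z0 : xc z0 ^+ 2 + yc z0 ^+ 2 = 4 / 33.
Proof. by rewrite xc_z0 /yc /= exprMn sqr_sqrtr //; field. Qed.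

Lemma fval_z0 v : fval v z0 = zr (height v) * (11 / 33 / yc z0).
Proof.
rewrite /fval /fv norm_z0 xc_z0 /height !zrE !zr_const; field.
exact: lt0r_neq0 (yc_gt0 z0).
Qed.

Lemma fval_height v v' : fval v z0 = fval v' z0 -> height v = height v'.
Proof.
rewrite !fval_z0 => /mulIf E; apply: (@zr_inj R); apply: E.
by rewrite !mulf_neq0 ?invr_eq0 ?pnatr_eq0 ?gt_eqF ?yc_gt0.
Qed.

Lemma reflection_act i j w t : t <> Z0 -> act (wall i) w = fscale t (wall j) ->
  sg j = ((gw w)^-1 * sg i * gw w)%g.
Proof.
move=> t0 E; have [p [q [r [s H]]]] := gw_represents w.
have zt0 : zr t != 0 by apply/negP => /eqP zt; apply: t0; apply: (@zr_inj R).
apply: (@reflection_conj R (hwall i) (hwall j) (zr t)^-1 _ _ _ _ _ H).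
  by rewrite invr_eq0.
move=> z; have := fval_gw (wall i) w z; rewrite E /fval /= => ->.
by rewrite !zrM (mulrCA 11) fv_scale mulKf.
Qed.

(* The deletion argument for Coxeter groups: the wall of the first letter is
   crossed again later on, and reflecting the part in between removes two
   letters. *)
Lemma gw_fix_z0 w : gw w z0 = z0 -> gw w = 1%g.
Proof.
have [n] := ubnP (size w); elim: n w => // n IHn [|i w] // sz fix0.
have h1 : height (act (wall i) w) = Z.opp 1.
  have := fval_gw (wall i) (i :: w) z0.
  rewrite fix0 -[act _ (i :: w)]/(act (wrefl i (wall i)) w) wrefl_wall act_scale.
  by move/fval_height; rewrite height_wall height_scale; lia.
have [] := @act_crossing (wall i) w (wall_root i).
- by rewrite height_wall.
- by rewrite h1.
move=> p [j [q [wE [t [t0 E]]]]].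
have gE : (sg i * gw w)%g = gw (p ++ q).
  rewrite wE !gw_cat gw_cons (reflection_act t0 E) !mulgA mulgK.
  by rewrite sgK mul1g.
rewrite gw_cons gE; apply: IHn; last by rewrite -gE -gw_cons.
by move: sz; rewrite wE /= !size_cat /= addnS !ltnS => /ltnW.
Qed.

Definition hexagon_group : set isom := range gw.

Lemma hexagon_group_subgroup : is_subgroup hexagon_group.
Proof.
split; first by exists [::].
by move=> _ _ [w _ <-] [w' _ <-]; exists (w ++ rev w') => //; rewrite gw_cat gw_rev.
Qed.

Lemma sg_in_group i : hexagon_group (sg i).
Proof. by exists [:: i] => //=; rewrite mulg1. Qed.

Lemma reflection_root v (D0 : Z.lt 0 (disc v)) : is_root v ->
  hexagon_group (reflection (hform_of D0)).
Proof.
have GM g h : hexagon_group g -> hexagon_group h -> hexagon_group (g * h)%g.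
  by move=> [w _ <-] [w' _ <-]; exists (w ++ w') => //; rewrite gw_cat.
have pos n : forall v (D0 : Z.lt 0 (disc v)), is_root v ->
    Z.lt 0 (height v) -> Z.le (height v) (Z.of_nat n) ->
    hexagon_group (reflection (hform_of D0)).
  elim: n => [|n IHn] {}v {}D0 rv hv hn; first by lia.
  have [i i0] := disc_gt0_pairing D0.
  have hE := height_wrefl i v.
  (* If the pairing reaches the height, v is a multiple of wall i and the descent ends; otherwise
     the reflected root has a smaller height, still positive. *)
  case: (Z.le_gt_cases (height v) (pairing i v)) => hi.
    have E := @negated_root i v rv (conj hv hi).
    rewrite (@reflection_scale R (hwall i) _ (zr (height v))); first exact: sg_in_group.
    - by apply/negP => /eqP zt; have := @zr_inj R _ Z0 zt; lia.
    - by rewrite [LHS]/= {1}(congr1 fa E) zrM mulrCA.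
    - by rewrite [LHS]/= {1}(congr1 fb E) zrM.
    - by rewrite [LHS]/= {1}(congr1 fc E) zrM.
  have rv' := wrefl_root i rv.
  have D0' := is_root_disc_gt0 rv'.
  have -> : reflection (hform_of D0) =
      ((sg i)^-1 * reflection (hform_of D0') * sg i)%g.
    apply: (@reflection_conj R _ _ 1 _ _ _ _ _ (represents_reflection (hwall i))).
      exact: oner_neq0.
    move=> z; rewrite mul1r.
    have := fval_sg i (wrefl i v) z; rewrite wreflK /fval /= => <- .
    by [].
  rewrite sgV; apply: (GM _ _ _ (sg_in_group i)); apply: (GM _ _ (sg_in_group i)).
  by apply: IHn => //; lia.
move=> rv; have h0 := root_height_neq0 rv.
case: (Z.lt_ge_cases 0 (height v)) => hv.
  by apply: (pos (Z.to_nat (height v))) => //; lia.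
have rv' := is_root_opp rv.
have D0' := is_root_disc_gt0 rv'.
rewrite (@reflection_scale R (hform_of D0') _ (- 1)).
- by apply: (pos (Z.to_nat (- height v))) => //; rewrite height_scale; lia.
- by rewrite oppr_eq0 oner_neq0.
- by rewrite /= zrM /zr /=; ring.
- by rewrite /= zrM /zr /=; ring.
- by rewrite /= zrM /zr /=; ring.
Qed.

End Hexagon.

(** * Subgroups, generators and finite index *)

Section GroupGen.
Variable gT : groupType.
Implicit Types (H K S : set gT) (g h : gT).

Lemma subgroupM H g h : is_subgroup H -> H g -> H h -> H (g * h)%g.
Proof.
move=> [H1 HV] Hg Hh; rewrite -[h]invgK; apply: (HV _ _ Hg).
by rewrite -[_^-1%g]mul1g; apply: HV.
Qed.

Lemma subgroupV H g : is_subgroup H -> H g -> H (g^-1)%g.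
Proof. by move=> [H1 HV] Hg; rewrite -[_^-1%g]mul1g; apply: HV. Qed.

Lemma subgroupI H K : is_subgroup H -> is_subgroup K -> is_subgroup (H `&` K).
Proof.
by move=> [H1 HV] [K1 KV]; split=> // g h [Hg Kg] [Hh Kh]; split; [apply: HV|apply: KV].
Qed.

Lemma mulg_conj_cancel g h k : h = (g^-1 * (g * h * k^-1) * k)%g.
Proof. by rewrite !mulgA mulVg mul1g -mulgA mulVg mulg1. Qed.

(* The cosets e K, e in E, are permuted by the generators, hence exhaust G. *)
Lemma finite_index_generated S K (E : seq gT) :
  is_subgroup K -> (forall s, S s -> S s^-1%g) -> 1%g \in E ->
  (forall s e, S s -> e \in E -> exists2 e', e' \in E & K (e'^-1 * s * e)%g) ->
  finite_index K (generated S).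
Proof.
move=> subK SV E1 step.
pose P g := forall e, e \in E -> exists2 e', e' \in E & K (e'^-1 * g * e)%g.
have PM g h : P g -> P h -> P (g * h)%g.
  move=> Pg Ph e /Ph[e1 e1E K1]; have [e2 e2E K2] := Pg _ e1E; exists e2 => //.
  by have := subgroupM subK K2 K1; rewrite !mulgA mulgK.
have genP g : generated S g -> P g /\ P g^-1%g.
  apply: (@smallest_sub _ (@is_subgroup gT) S [set g | P g /\ P g^-1%g]).
    split=> [|{}g h [Pg PgV] [Ph PhV] /=].
      by rewrite /= invg1; split=> e eE; exists e => //; rewrite mulg1 mulVg;
        case: subK.
    by rewrite invgM invgK; split; apply: PM.
  by move=> s Ss; split=> e eE; apply: step => //; apply: SV.
apply: (@sub_finite_set _ _ [set [set (e * k)%g | k in K] | e in [set` E]]).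
  move=> _ [g Gg <-]; have [Pg _] := genP _ Gg; have [e eE] := Pg _ E1.
  rewrite mulg1 => Keg; exists e => //.
  apply/seteqP; split=> _ [k Kk <-].
    exists (g^-1 * e * k)%g; last by rewrite !mulgA mulgV mul1g.
    have := subgroupV subK Keg; rewrite invgM invgK => Kge.
    exact: subgroupM.
  exists (e^-1 * g * k)%g; last by rewrite !mulgA mulgV mul1g.
  exact: subgroupM.
by apply: finite_image; exact: finite_seq.
Qed.

End GroupGen.

HB.instance Definition _ := gen_eqMixin zmat.
HB.instance Definition _ := gen_eqMixin side.

(** * Integer matrices acting: failure of congruence, commensurability *)

Section Matrices.
Variable R : realType.
Notation isom := (isom R).
Notation zr := (@zr R).
Implicit Types (g h : isom) (z : uhp R) (m n : zmat) (w : seq side).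

Definition mrep m g : Prop :=
  represents (zr (m11 m)) (zr (m12 m)) (zr (m21 m)) (zr (m22 m)) g.

Lemma zr_neq0 k : k <> Z0 -> zr k != 0.
Proof. by move=> k0; apply/negP => /eqP zk; apply: k0; apply: (@zr_inj R). Qed.

Lemma mrep_scale k m g : k <> Z0 -> mrep (zmscale k m) g <-> mrep m g.
Proof. by move=> /zr_neq0 k0; rewrite /mrep /= !zrM; apply: represents_scale. Qed.

Lemma mrep_mul m n g h : mrep m g -> mrep n h -> mrep (mmul m n) (g * h)%g.
Proof. by rewrite /mrep /= !zrE; apply: represents_mul. Qed.

Lemma mrep_adj m g : mrep m g -> mrep (madj m) g^-1%g.
Proof. by rewrite /mrep /= !zrE; apply: represents_inv. Qed.

Lemma mrep1 : mrep mat1 1%g.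
Proof. by rewrite /mrep /= !zr_const; apply: represents1. Qed.

Lemma mrep_eq m g h : mrep m g -> mrep m h -> g = h.
Proof. exact: represents_eq. Qed.

Lemma mrep_side i : mrep (side_mat i) (sg R i).
Proof.
have k0 : side_scale i <> Z0 by case: i.
apply/(mrep_scale _ _ k0); rewrite side_matE /mrep /=.
have := represents_reflection (hwall R i).
by rewrite /= !zrN !zrM zr_const zr_const.
Qed.

Lemma mrep_word w : mrep (word_mat w) (gw R w).
Proof.
elim: w => [|i w IHw]; first exact: mrep1.
by rewrite gw_cons; apply: mrep_mul => //; exact: mrep_side.
Qed.

Lemma mrep_proportional m n g h : proportional m n -> mrep m g -> mrep n h -> g = h.
Proof.
move=> mn mg nh.
have det_neq0 k f : mrep k f -> mdet k <> Z0.
  move=> [d0 _] k0; move: d0; rewrite -!zrM -zrB.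
  by rewrite -[Z.sub _ _]/(mdet k) k0 zr_const eqxx.
have [k [l [k0 l0 E]]] := proportionalP mn (det_neq0 _ _ mg) (det_neq0 _ _ nh).
apply: (@mrep_eq (zmscale k m)); first exact/mrep_scale.
by rewrite E; apply/mrep_scale.
Qed.

Lemma zr_Z_of_int (x : int) : zr (Z_of_int x) = x%:~R.
Proof. by rewrite /zr Z_of_intK. Qed.

Definition intmx m : 'M[int]_2 := \matrix_(i, j)
  if i == 0 then if j == 0 then int_of_Z (m11 m) else int_of_Z (m12 m)
  else if j == 0 then int_of_Z (m21 m) else int_of_Z (m22 m).

Lemma det_intmx m : mdet m = Zpos 1 -> \det (intmx m) = 1.
Proof. by move=> dm; rewrite det_mx2 !mxE /= -!int_of_ZM -int_of_ZB -/(mdet m) dm. Qed.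

Lemma mrep_PSL2Z m g : mrep m g -> mdet m = Zpos 1 -> PSL2Z g.
Proof.
move=> mg dm.
have dA := det_intmx dm; set A := intmx m in dA.
by exists A; split=> //; apply: acts_as_represents => //; rewrite !mxE.
Qed.

Lemma PSL2Z_mrep g : PSL2Z g -> exists m, mdet m = Zpos 1 /\ mrep m g.
Proof.
move=> [A [dA /(represents_acts_as dA) gA]].
exists (Mat (Z_of_int (A 0 0)) (Z_of_int (A 0 1)) (Z_of_int (A 1 0)) (Z_of_int (A 1 1))).
split; last by rewrite /mrep /= !zr_Z_of_int.
apply: (can_inj int_of_ZK); rewrite /mdet /=.
rewrite int_of_ZB !int_of_ZM !Z_of_intK.
by rewrite -det_mx2 dA.
Qed.

Lemma mrep_exists m : mdet m = Zpos 1 -> exists g, mrep m g.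
Proof.
move=> dm; have d1 : zr (m11 m) * zr (m22 m) - zr (m12 m) * zr (m21 m) = 1.
  by rewrite -!zrM -zrB -[Z.sub _ _]/(mdet m) dm zr_const.
have dA := det_intmx dm; set A := intmx m in dA.
have [g /(represents_acts_as dA)] := acts_as_exists R dA.
by rewrite !mxE /=; exists g.
Qed.

Lemma mrep_principal_congruence (n : nat) k1 k2 k3 k4 g :
  let N := Z.of_nat n in
  let m := Mat (Z.add 1 (Z.mul N k1)) (Z.mul N k2) (Z.mul N k3) (Z.add 1 (Z.mul N k4)) in
  mdet m = Zpos 1 -> mrep m g -> principal_congruence n g.
Proof.
move=> N m dm mg.
have dA := det_intmx dm; set A := intmx m in dA.
have NE : int_of_Z N = n by rewrite /N; case: (n) => //= k; rewrite SuccNat2Pos.id_succ.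
have e1 (x : int) : int_of_Z (Zpos xH) + x - 1 = x by rewrite addrAC subrr add0r.
exists A; split=> //.
- by apply: acts_as_represents => //; rewrite !mxE.
- split; apply/eqP; rewrite eqz_mod_dvd subr0 !mxE /= int_of_ZM NE;
    exact: dvdz_mulr.
- left; split; apply/eqP; rewrite eqz_mod_dvd !mxE /= int_of_ZD
    int_of_ZM NE e1; exact: dvdz_mulr.
Qed.

Lemma PSL2Z_subgroup : is_subgroup (@PSL2Z R).
Proof.
split; first by apply: (mrep_PSL2Z mrep1).
move=> g h /PSL2Z_mrep[m [dm mg]] /PSL2Z_mrep[n [dn nh]].
apply: (mrep_PSL2Z (mrep_mul mg (mrep_adj nh))).
by rewrite mdet_mul mdet_adj dm dn.
Qed.

Lemma translation_in_group k : exists2 g, hexagon_group g & mrep (Mat 1 k 0 1) g.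
Proof.
have step : exists2 g, hexagon_group g & mrep (Mat 1 1 0 1) g.
  exists (gw R [:: S1; S0]); first by exists [:: S1; S0].
  exact: (mrep_word [:: S1; S0]).
have nat_step (j : nat) : exists2 g, hexagon_group g & mrep (Mat 1 (Z.of_nat j) 0 1) g.
  elim: j => [|j [g Gg gE]].
    by exists 1%g; [case: (hexagon_group_subgroup R)|exact: mrep1].
  have [t Gt tE] := step; exists (g * t)%g.
    exact: (subgroupM (hexagon_group_subgroup R)).
  by have := mrep_mul gE tE; congr mrep; congr Mat => /=; lia.
case: (Z.le_ge_cases 0 k) => k0.
  by have := nat_step (Z.to_nat k); rewrite Z2Nat.id.
have [g Gg gE] := nat_step (Z.to_nat (- k)); exists g^-1%g.
  exact: (subgroupV (hexagon_group_subgroup R)).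
by have := mrep_adj gE; congr mrep; congr Mat => /=; lia.
Qed.

Lemma lower_in_group k : exists2 g, hexagon_group g & mrep (Mat 1 0 (Z.mul 11 k) 1) g.
Proof.
have [g Gg gE] := translation_in_group k; exists (sg R S5 * g * sg R S5)%g.
  have GM := subgroupM (hexagon_group_subgroup R).
  by apply: (GM _ _) (sg_in_group R S5); apply: (GM _ _) => //; exact: sg_in_group.
apply/(@mrep_scale 11) => //.
have := mrep_mul (mrep_mul (mrep_side S5) gE) (mrep_side S5).
by congr mrep; rewrite /mmul /zmscale; congr Mat => /=; lia.
Qed.

(* This involution fixes z0 and preserves the hexagon, rotating it. *)
Lemma involution_notin_group g : mrep (Mat 11 (-4) 33 (-11)) g -> ~ hexagon_group g.
Proof.
rewrite /mrep /= !zrNeg !zr_const => gE [w _ wE].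
suff g1 : g = 1%g.
  have [_ E1] := represents1 R; have [_] := gE; rewrite g1.
  move/(_ (pt 0 ltr01)) => [/= + _].
  by rewrite /den /xc /yc /=; lra.
rewrite -wE; apply: gw_fix_z0; rewrite wE.
have [_ /(_ (z0 R))[]] := gE; set x := xc _; set y := yc (g _).
rewrite /den xc_z0; have := norm_z0 R; rewrite xc_z0.
have y0 := yc_gt0 (z0 R); set t := yc (z0 R) in y0 * => tE.
have tt : t ^+ 2 = 11%:R / 1089%:R by move: tE; lra.
have tt' : (33 * t) ^+ 2 = 11 by rewrite exprMn tt; lra.
rewrite tt' tt => ex ey.
have n11 : `|11 * - 11 - - 4 * 33| = 11 :> R.
  by rewrite gtr0_norm; lra.
rewrite n11 in ey.
apply: uhp_eq; rewrite -/x -/y -/t ?xc_z0.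
  by move: ex; lra.
by move: ey; lra.
Qed.

Lemma hexagon_group_not_congruence : ~ congruence_group (@hexagon_group R).
Proof.
move=> [n [n0 nG]].
(* The translation by k, which lies in the group, turns the corner entry 23 into 23 + 55 k,
   invertible modulo n as [congruence_word] requires. *)
have [k ak] := @coprime_shift 23 55 n isT isT n0.
pose K := Z.of_nat k; pose N := Z.of_nat n.
have [u [t ut]] : exists u t : Z, Z.mul u (Z.add 23 (Z.mul 55 K)) = Z.add 1 (Z.mul N t).
  have [[u t] /= E] := coprimeP _ (isT : (0 < 23 + 55 * k)%N) ak.
  exists (Z.of_nat u), (Z.of_nat t); move: E; rewrite /K /N.
  have -> : Z.add 23 (Z.mul 55 (Z.of_nat k)) = Z.of_nat (23 + 55 * k)%N.
    by rewrite -plusE -multE Nat2Z.inj_add Nat2Z.inj_mul.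
  by rewrite -!Nat2Z.inj_mul -minusE -!multE; lia.
have GM := subgroupM (hexagon_group_subgroup R).
have [gX X] := @mrep_exists (Mat 23 5 55 12) erefl.
have [U GU UE] := translation_in_group K.
have [L1 G1 L1E] := lower_in_group (Z.mul 5 u).
have [L2 G2 L2E] := lower_in_group (Z.opp (Z.mul u (Z.add 2 (Z.mul 5 K)))).
have [U1 GU1 U1E] := translation_in_group 1.
have [L3 G3 L3E] := lower_in_group (Z.add 2 (Z.mul 5 K)).
have [U2 GU2 U2E] := translation_in_group (Z.opp u).
have [U3 GU3 U3E] := translation_in_group (Z.mul (Z.add 5 (Z.mul 12 K)) u).
set h := (L1 * (L2 * U1 * L3 * U2) * U3)%g.
have Gh : hexagon_group h.
  apply: (GM _ _ _ GU3); apply: (GM _ _ G1); apply: (GM _ _ _ GU2).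
  by apply: (GM _ _ _ G3); exact: (GM _ _ G2 GU1).
have hE : mrep (congruence_word K u) h.
  exact: (mrep_mul (mrep_mul L1E (mrep_mul (mrep_mul (mrep_mul L2E U1E) L3E) U2E)) U3E).
have := mrep_mul (mrep_mul UE X) (mrep_adj hE).
have [k1 [k2 [k3 [k4 E]]]] := congruence_wordP ut.
rewrite E => /mrep_principal_congruence PC.
have {PC}GXh : hexagon_group (U * gX * h^-1)%g.
  apply: nG; apply: PC; rewrite -E !mdet_mul mdet_adj !mdet_mul /mdet /=.
  by lia.
have GX : hexagon_group gX.
  rewrite (mulg_conj_cancel U gX h).
  by apply: (GM _ _ _ Gh); apply: (GM _ _ (subgroupV (hexagon_group_subgroup R) GU)).
(* This word carries the image of z0 under [gX] back to z0; its product with [gX] is the rotation,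
   up to the scalar m11 M / 11. *)
apply: (@involution_notin_group (gw R [:: S3; S2; S5; S2; S5; S2] * gX)%g); last first.
  by apply: GM GX; exists [:: S3; S2; S5; S2; S5; S2].
have := mrep_mul (mrep_word [:: S3; S2; S5; S2; S5; S2]) X.
set M := mmul _ _ => ME.
have ME' : M = zmscale (m11 M / 11) (Mat 11 (-4) 33 (-11)) by vm_compute.
by move: ME; rewrite ME' mrep_scale.
Qed.

Definition modular_gens : set isom :=
  [set g | mrep matS g \/ mrep matT g \/ mrep matTV g].

Lemma modular_gensV g : modular_gens g -> modular_gens g^-1%g.
Proof.
move=> [|[]] /mrep_adj H; [left|right; right|right; left] => //.
by apply/(@mrep_scale (Zneg xH)).
Qed.

Lemma generated_subgroup (gT : groupType) (S : set gT) : is_subgroup (generated S).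
Proof.
split=> [H [[H1 _] _] //|g h Gg Gh H HS].
by have [[_ HV] _] := HS; apply: HV; [exact: Gg|exact: Gh].
Qed.

Lemma PSL2Z_generated : @PSL2Z R `<=` generated modular_gens.
Proof.
have subH := generated_subgroup modular_gens.
move=> g /PSL2Z_mrep[m [dm]].
elim/SL2Z_ind: dm g => [g g1|g g1|{}m IH g mg|{}m IH g mg|{}m IH g mg].
- by rewrite (mrep_eq g1 mrep1); case: subH.
- by rewrite (mrep_eq g1 ((mrep_scale mat1 1%g (_ : Zneg xH <> Z0)).2 mrep1)) //; case: subH.
- have [h hE] := @mrep_exists matS erefl.
  have := IH _ (mrep_mul hE mg).
  have Gh : generated modular_gens h by apply: sub_gen_smallest; left.
  by move=> /(subgroupM subH (subgroupV subH Gh)); rewrite mulgA mulVg mul1g.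
- have [h hE] := @mrep_exists matT erefl.
  have := IH _ (mrep_mul hE mg).
  have Gh : generated modular_gens h by apply: sub_gen_smallest; right; left.
  by move=> /(subgroupM subH (subgroupV subH Gh)); rewrite mulgA mulVg mul1g.
- have [h hE] := @mrep_exists matTV erefl.
  have := IH _ (mrep_mul hE mg).
  have Gh : generated modular_gens h by apply: sub_gen_smallest; right; right.
  by move=> /(subgroupM subH (subgroupV subH Gh)); rewrite mulgA mulVg mul1g.
Qed.

Lemma hexagon_group_generated : hexagon_group (R := R) = generated (range (sg R)).
Proof.
have subH := generated_subgroup (range (sg R)).
apply/seteqP; split=> [_ [w _ <-]|].
  elim: w => [|i w IHw]; first by case: subH.
  by rewrite gw_cons; apply: (subgroupM subH) IHw; apply: sub_gen_smallest; exists i.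
by apply: smallest_sub; [exact: hexagon_group_subgroup|move=> _ [i _ <-]; exact: sg_in_group].
Qed.

Lemma hexagon_group_commensurable : commensurable (@hexagon_group R) (@PSL2Z R).
Proof.
have subK := subgroupI (hexagon_group_subgroup R) PSL2Z_subgroup.
have GM := subgroupM (hexagon_group_subgroup R).
have GV := subgroupV (hexagon_group_subgroup R).
have PM := subgroupM PSL2Z_subgroup; have PV := subgroupV PSL2Z_subgroup.
split.
  rewrite {2}hexagon_group_generated.
  apply: (@finite_index_generated _ _ _ [seq gw R w | w <- hexagon_reps]) => //.
  - by move=> _ [i _ <-]; rewrite sgV; exists i.
  - by rewrite inE eqxx.
  move=> _ _ [i _ <-] /mapP[v vin ->].
  have iin : i \in all_sides by case: i; rewrite !inE eqxx ?orbT.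
  have /hasP[v' v'in ok] := allP (allP hexagon_table i iin) v vin.
  exists (gw R v'); first exact: map_f.
  have gE : ((gw R v')^-1 * sg R i * gw R v)%g = gw R (rev v' ++ i :: v).
    by rewrite gw_cat gw_cons gw_rev mulgA.
  rewrite gE; split; first by exists (rev v' ++ i :: v).
  have [k [n [k0 nE dn]]] := unimodular_up_to_scaleP ok.
  apply: mrep_PSL2Z dn; apply/(mrep_scale _ _ k0).
  by rewrite -nE; apply: mrep_word.
(* A choice of isometry for each matrix; the default 1 is never reached on [modular_reps], whose
   members have determinant 1. *)
pose iso m : isom := if pselect (exists g, mrep m g) is left e then sval (cid e) else 1%g.
have isoE m : m \in modular_reps -> mrep m (iso m).
  move=> /(allP modular_reps_det) /Z.eqb_spec dm; rewrite /iso.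
  case: pselect => [e|[]]; first by case: cid.
  exact: mrep_exists.
have isoP m : m \in modular_reps -> PSL2Z (iso m).
  move=> min; apply: (mrep_PSL2Z (isoE _ min)).
  by apply/Z.eqb_spec; exact: (allP modular_reps_det).
have fin : finite_index (hexagon_group (R := R) `&` PSL2Z (R := R)) (generated modular_gens).
  apply: (@finite_index_generated _ _ _ [seq iso m | m <- modular_reps]) => //.
  - exact: modular_gensV.
  - have min : mat1 \in modular_reps by rewrite inE eqxx.
    by rewrite (mrep_eq mrep1 (isoE _ min)) map_f.
  move=> s _ gs /mapP[r rin ->].
  have Ps : PSL2Z s by case: gs => [|[]] /mrep_PSL2Z; apply.
  suff [r' r'in [w gE]] : exists2 r', r' \in modular_reps &
      exists w, ((iso r')^-1 * s * iso r)%g = gw R w.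
    exists (iso r'); first exact: map_f.
    split; first by rewrite gE; exists w.
    by apply: (PM _ _ _ (isoP _ rin)); apply: (PM _ _ _ Ps); apply: PV; apply: isoP.
  have [gm gmin sE] : exists2 gm, gm \in [:: matS; matT; matTV] & mrep gm s.
    by case: gs => [|[]] H; [exists matS|exists matT|exists matTV]; rewrite // !inE eqxx ?orbT.
  have /hasP[r' r'in /hasP[w _ wE]] := allP (allP modular_table gm gmin) r rin.
  exists r' => //; exists w; apply: (mrep_proportional wE _ (mrep_word w)).
  rewrite -mulgA; apply: (mrep_mul (mrep_adj (isoE _ r'in))).
  exact: mrep_mul (isoE _ rin).
apply: sub_finite_set fin => _ [g Pg <-]; exists g => //.
exact: PSL2Z_generated.
Qed.

End Matrices.

Lemma finite_index_power (gT : groupType) (K H : set gT) (g : gT) :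
  is_subgroup H -> is_subgroup K -> finite_index (H `&` K) H -> H g ->
  exists2 n, (0 < n)%N & K (g ^+ n)%g.
Proof.
move=> subH subK /finite_seqP[cosets cosetsE] Hg.
have subHK := subgroupI subH subK.
have Hgn n : H (g ^+ n)%g.
  elim: n => [|n IHn]; first by rewrite expg0; case: subH.
  by rewrite expgS; apply: subgroupM.
pose f n := [set (g ^+ n * k)%g | k in H `&` K].
have fin n : f n \in cosets.
  have : [set` cosets] (f n) by rewrite -cosetsE; exists (g ^+ n)%g.
  by [].
pose s := [seq f n | n <- iota 0 (size cosets).+1].
have /(uniqPn set0)[i [j [ij]]] : ~~ uniq s.
  apply/negP => us; have : (size s <= size cosets)%N.
    by apply: uniq_leq_size => // _ /mapP[n _ ->].
  by rewrite size_map size_iota ltnn.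
rewrite size_map size_iota => js.
rewrite !(nth_map 0%N) ?size_iota ?(ltn_trans ij) // !nth_iota ?(ltn_trans ij) //.
rewrite !add0n => fij; exists (j - i)%N; first by rewrite subn_gt0.
have [k [_ Kk] kE] : f i (g ^+ j)%g.
  by rewrite fij; exists 1%g; [case: subHK|rewrite mulg1].
by move: kE; rewrite -[in RHS](subnKC (ltnW ij)) expgnDr => /mulgI <-.
Qed.

(** * Reflections in a larger group commensurable with PSL2(Z) *)

Section Arithmetic.
Variable R : realType.
Notation isom := (isom R).
Notation zr := (@zr R).
Implicit Types (g h : isom) (z : uhp R).

(** An isometry determines its normalised matrix only up to sign, so just the quadratic expressions
    in the entries are compared. They are read off by pulling back |z|^2, Re z and 1. *)
Lemma represents_mrep m p q r s g : mdet m = Zpos 1 -> mrep m g -> represents p q r s g ->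
  let d := `|p * s - q * r| in
  [/\ p * p = d * zr (Z.mul (m11 m) (m11 m)), q * q = d * zr (Z.mul (m12 m) (m12 m)),
      r * r = d * zr (Z.mul (m21 m) (m21 m)), s * s = d * zr (Z.mul (m22 m) (m22 m)) &
      p * s + q * r =
        d * zr (Z.add (Z.mul (m11 m) (m22 m)) (Z.mul (m12 m) (m21 m)))].
Proof.
move=> dm gm gE /=.
have dR : zr (m11 m) * zr (m22 m) - zr (m12 m) * zr (m21 m) = 1.
  by rewrite -!zrM -zrB -[Z.sub _ _]/(mdet m) dm zr_const.
have [d0 _] := gE; have n0 : `|p * s - q * r| != 0 by rewrite normr_eq0.
have key a b c z := etrans (esym (fv_represents a b c z gE)) (fv_represents a b c z gm).
rewrite dR normr1 in key.
have key2 a b c := @fv_inj _ _ _ _ _ _ _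
  (fun z => etrans (etrans (fv_scale `|p * s - q * r|^-1 _ _ _ z) (mulrC _ _))
    (etrans (key a b c z) (divr1 _))).
have move_d (x y : R) : `|p * s - q * r|^-1 * x = y -> x = `|p * s - q * r| * y.
  by move=> <-; rewrite mulVKf.
have [/move_d e1 _ /move_d e2] := key2 1 0 0.
have [/move_d e3 _ /move_d e4] := key2 0 0 1.
have [_ /move_d e5 _] := key2 0 1 0.
rewrite !zrE -!expr2; split.
- by move: e1; rewrite !mul0r !addr0 !mul1r.
- by move: e2; rewrite !mul0r !addr0 !mul1r.
- by move: e3; rewrite !mul0r !add0r !mul1r.
- by move: e4; rewrite !mul0r !add0r !mul1r.
- by move: e5; rewrite !mulr0 !mul0r !add0r !addr0 !mul1r.
Qed.

Definition mpower (m : zmat) n : zmat :=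
  let c := power_coef (Z.add (m11 m) (m22 m)) (mdet m) n in
  Mat (Z.add (Z.mul c.1 (m11 m)) c.2) (Z.mul c.1 (m12 m)) (Z.mul c.1 (m21 m))
    (Z.add (Z.mul c.1 (m22 m)) c.2).

Lemma mrep_power m g n : mrep m g -> mrep (mpower m n) (g ^+ n)%g.
Proof.
move=> gE; elim: n => [|n IHn].
  by rewrite expg0; have := mrep1 R; congr mrep; rewrite /mpower /=; congr Mat; lia.
rewrite expgS; have := mrep_mul gE IHn; congr mrep.
rewrite /mpower /mmul /=; case: (power_coef _ _ n) => x y /=.
by rewrite /mdet; congr Mat; lia.
Qed.

(** Normalising m itself would need a square root of its determinant; m^2 / det m has determinant 1
    and rational entries. So the argument is run on the square of g, whose trace is (tr m)^2 - 2 det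
    m before normalisation. *)
Lemma trace_dvd m g n : mrep m g -> Z.lt 0 (mdet m) -> (0 < n)%N -> PSL2Z (g ^+ n)%g ->
  Z.divide (mdet m) (Z.mul (Z.add (m11 m) (m22 m)) (Z.add (m11 m) (m22 m))).
Proof.
move=> gE d0 n0 gn.
have g2 := mrep_power n (mrep_mul gE gE); rewrite -expg2 expgnAC expg2 in g2.
have /PSL2Z_mrep[m' [dm' gm']] := subgroupM (PSL2Z_subgroup R) gn gn.
have := represents_mrep dm' gm' g2.
rewrite {gm' g2}; set M := mpower _ _.
have dM : mdet M = zpow (Z.mul (mdet m) (mdet m)) n.
  rewrite /M -mdet_mul -(power_coef_norm (Z.add (m11 (mmul m m)) (m22 (mmul m m)))).
  by rewrite /mpower /mdet /=; case: (power_coef _ _ n) => x y /=; lia.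
have tM : Z.add (m11 M) (m22 M) = power_trace (Z.sub (Z.mul (Z.add (m11 m) (m22 m))
    (Z.add (m11 m) (m22 m))) (Z.mul 2 (mdet m))) (Z.mul (mdet m) (mdet m)) n.
  rewrite /power_trace -mdet_mul.
  have -> : Z.sub (Z.mul (Z.add (m11 m) (m22 m)) (Z.add (m11 m) (m22 m))) (Z.mul 2 (mdet m)) =
    Z.add (m11 (mmul m m)) (m22 (mmul m m)) by rewrite /mdet /=; lia.
  by rewrite /M /mpower; case: (power_coef _ _ n) => x y /=; lia.
have dMR : zr (m11 M) * zr (m22 M) - zr (m12 M) * zr (m21 M) = zr (mdet M).
  by rewrite /mdet !zrE.
have dM0 : Z.lt 0 (mdet M).
  rewrite dM; elim: (n) => [|k IHk] //=.
  by apply: Z.mul_pos_pos => //; apply: Z.mul_pos_pos.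
rewrite dMR gtr0_norm ?zr_gt0; last exact/Z.ltb_lt.
cbv zeta; rewrite -!zrM -zrD => -[/(@zr_inj R) e1 _ _ /(@zr_inj R) e2 /(@zr_inj R) e3].
apply: (@power_trace_dvd _ _ (Z.add (m11 m') (m22 m')) n) => //.
rewrite -tM -dM.
(* The square of a trace is p^2 + s^2 + 2 p s, with 2 p s the sum of p s + q r and the determinant;
   so the three comparisons kept above give (tr M)^2 = det M (tr m')^2. *)
have e4 : Z.sub (Z.mul (m11 M) (m22 M)) (Z.mul (m12 M) (m21 M)) = mdet M by [].
have e5 : Z.sub (Z.mul (m11 m') (m22 m')) (Z.mul (m12 m') (m21 m')) = Zpos xH by [].
have e6 : Z.mul (mdet M) (Z.sub (Z.mul (m11 m') (m22 m')) (Z.mul (m12 m') (m21 m'))) = mdet M.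
  by rewrite e5; lia.
clear - e1 e2 e3 e4 e6; lia.
Qed.

(** Here g is 1 + N with N = [[al, be], [ga, -al]] of square zero, so its n-th power is 1 + n N. *)
Lemma unipotent_power (al be ga : R) g n : al ^+ 2 + be * ga = 0 ->
  represents (1 + al) be ga (1 - al) g ->
  represents (1 + n%:R * al) (n%:R * be) (n%:R * ga) (1 - n%:R * al) (g ^+ n)%g.
Proof.
move=> nil gE; have bg : be * ga = - al ^+ 2 by apply/eqP; rewrite -addr_eq0 addrC nil.
elim: n => [|n IHn].
  by rewrite expg0 !mul0r addr0 subr0; exact: represents1.
rewrite expgS; have := represents_mul gE IHn.
congr represents; rewrite -natr1.
- have -> : be * (n%:R * ga) = n%:R * (be * ga) by ring.
  by rewrite bg; ring.
- by ring.
- by ring.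
- have -> : ga * (n%:R * be) = n%:R * (be * ga) by ring.
  by rewrite bg; ring.
Qed.

Lemma unipotent_integral (al be ga : R) g n : al ^+ 2 + be * ga = 0 ->
  represents (1 + al) be ga (1 - al) g -> PSL2Z (g ^+ n)%g ->
  exists x y t : Z, [/\ n%:R * al = zr x, n%:R * be = zr y & n%:R * ga = zr t].
Proof.
move=> nil gE /PSL2Z_mrep[m [dm gm]]; have H := unipotent_power n nil gE.
have bg : be * ga = - al ^+ 2 by apply/eqP; rewrite -addr_eq0 addrC nil.
have := represents_mrep dm gm H.
have -> : (1 + n%:R * al) * (1 - n%:R * al) - n%:R * be * (n%:R * ga) = 1.
  have -> : n%:R * be * (n%:R * ga) = n%:R ^+ 2 * (be * ga) by ring.
  by rewrite bg; ring.
have root (u : R) v : u * u = `|1| * zr (Z.mul v v) -> exists w, u = zr w.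
  rewrite normr1 mul1r zrM -!expr2 => /eqP; rewrite eqf_sqr => /orP[] /eqP ->.
    by exists v.
  by exists (Z.opp v); rewrite zrN.
move=> [/root[p' e1] /root[q' e2] /root[r' e3] _ _].
exists (Z.sub p' 1), q', r'; split=> //.
by rewrite zrB zr_const -e1 addrC addKr.
Qed.

Lemma reflection_rational (l : hform R) (G' : set isom) :
  is_subgroup G' -> finite_index (G' `&` @PSL2Z R) G' -> @hexagon_group R `<=` G' ->
  G' (reflection l) ->
  exists t a b c, [/\ t != 0, qa l = t * zr a, qb l = t * zr b & qc l = t * zr c].
Proof.
move=> subG' fin GG' G'l.
have lE := represents_reflection l.
have l0 := disc_gt0 l.
set a := qa l in l0 lE *; set b := qb l in l0 lE *; set c := qc l in l0 lE *.
set D := b ^+ 2 - 4 * a * c in l0.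
have conj u : G' u -> G' (reflection l * u * reflection l)%g.
  by move=> G'u; do 2 apply: (subgroupM subG') => //.
have D0 : D != 0 by rewrite gt_eqF.
have [gT GT TE] := @translation_in_group R 1.
have [gL GL LE] := @lower_in_group R 1.
have [k1 k10 K1] := finite_index_power subG' (PSL2Z_subgroup R) fin (conj _ (GG' _ GT)).
have [k2 k20 K2] := finite_index_power subG' (PSL2Z_subgroup R) fin (conj _ (GG' _ GL)).
have rT : represents (1 + - (2 * a * b / D)) (- (b ^+ 2 / D)) (4 * a ^+ 2 / D)
    (1 - - (2 * a * b / D)) (reflection l * gT * reflection l)%g.
  apply/(represents_scale _ _ _ _ _ D0).
  have := represents_mul (represents_mul lE TE) lE.
  by congr represents; rewrite /= ?zr_const /D; field; rewrite gt_eqF.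
have rL : represents (1 + 22 * b * c / D) (44 * c ^+ 2 / D) (- (11 * b ^+ 2 / D))
    (1 - 22 * b * c / D) (reflection l * gL * reflection l)%g.
  apply/(represents_scale _ _ _ _ _ D0).
  have := represents_mul (represents_mul lE LE) lE.
  by congr represents; rewrite /= ?zrM ?zr_const /D; field; rewrite gt_eqF.
have nT : (- (2 * a * b / D)) ^+ 2 + - (b ^+ 2 / D) * (4 * a ^+ 2 / D) = 0 by field.
have nL : (22 * b * c / D) ^+ 2 + 44 * c ^+ 2 / D * - (11 * b ^+ 2 / D) = 0 by field.
have [x1 [y1 [z1 [ab bb aa]]]] := unipotent_integral nT rT K1.
have [x2 [y2 [z2 [bc cc _]]]] := unipotent_integral nL rL K2.
pose K : R := 44 * k1%:R * k2%:R.
have K0 : K != 0 by rewrite !mulf_neq0 ?pnatr_eq0 -?lt0n.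
have k1R : k1%:R != 0 :> R by rewrite pnatr_eq0 -lt0n.
have k2R : k2%:R != 0 :> R by rewrite pnatr_eq0 -lt0n.
have zk k : k%:R = zr (Z.of_nat k).
  by rewrite /zr; case: k => //= k; rewrite SuccNat2Pos.id_succ.
(* The form is multiplied by one of its own coefficients, over D, and K clears denominators. For a
   <> 0 this gives a^2, a b and a c over D, the last from 4 a c / D = b^2 / D - 1. For a = 0 one
   multiplies by b, and b c / D comes from the conjugate of the lower unipotent. *)
have [a0|a0] := eqVneq a 0; last first.
  exists (D / (K * a)), (Z.mul (Z.mul 11 (Z.of_nat k2)) z1),
    (Z.opp (Z.mul (Z.mul 22 (Z.of_nat k2)) x1)),
    (Z.opp (Z.add (Z.mul (Z.mul 11 (Z.of_nat k2)) y1)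
      (Z.mul 11 (Z.mul (Z.of_nat k1) (Z.of_nat k2))))).
  rewrite !zrE -!zk -ab -bb -aa !zr_const; split.
  - by rewrite mulf_neq0 ?invr_eq0 ?mulf_neq0.
  - by move: D0; rewrite /K /D => D0; field; rewrite ?k1R ?k2R ?a0 ?D0.
  - by move: D0; rewrite /K /D => D0; field; rewrite ?k1R ?k2R ?a0 ?D0.
  - by move: D0; rewrite /K /D => D0; field; rewrite ?k1R ?k2R ?a0 ?D0.
have b0 : b != 0.
  by apply: contraTneq l0 => bE; rewrite /D bE a0 !mulr0 mul0r expr0n subrr ltxx.
exists (D / (K * b)), Z0, (Z.opp (Z.mul (Z.mul 44 (Z.of_nat k2)) y1)),
  (Z.mul (Z.mul 2 (Z.of_nat k1)) x2).
rewrite !zrE -!zk -bb -bc !zr_const a0; split.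
- by rewrite mulf_neq0 ?invr_eq0 ?mulf_neq0.
- by rewrite mulr0.
- by rewrite /K; field; rewrite ?k1R ?k2R ?b0 ?D0.
- by rewrite /K; field; rewrite ?k1R ?k2R ?b0 ?D0.
Qed.

Lemma reflection_in_group (l : hform R) (G' : set isom) :
  is_subgroup G' -> finite_index (G' `&` @PSL2Z R) G' -> @hexagon_group R `<=` G' ->
  G' (reflection l) -> @hexagon_group R (reflection l).
Proof.
move=> subG' fin GG' G'l.
have [t [a1 [b1 [c1 [t0 aE bE cE]]]]] := reflection_rational subG' fin GG' G'l.
have l0 := disc_gt0 l.
have [[a0 [b0 c0]]|k [a [b [c [k0 a1E b1E c1E prim]]]]] := @primitive_multiple a1 b1 c1.
  move: l0; rewrite aE bE cE a0 b0 c0 zr_const !mulr0.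
  by rewrite expr0n subrr ltxx.
have kt0 : t * zr k != 0 by rewrite mulf_neq0 // zr_neq0.
have {}aE : qa l = t * zr k * zr a by rewrite aE a1E zrM mulrA.
have {}bE : qb l = t * zr k * zr b by rewrite bE b1E zrM mulrA.
have {}cE : qc l = t * zr k * zr c by rewrite cE c1E zrM mulrA.
pose D := (Z.sub (Z.mul b b) (Z.mul (Z.mul 4 a) c)).
have D0 : Z.lt 0 D.
  apply/Z.ltb_lt; rewrite -(zr_gt0 R) /D !zrE zr_const.
  have : 0 < (t * zr k) ^+ 2 by rewrite exprn_even_gt0.
  move=> /pmulr_rgt0 <-; move: l0; rewrite aE bE cE; congr (0 < _); ring.
have rE : mrep (Mat (Z.opp b) (Z.opp (Z.mul 2 c)) (Z.mul 2 a) b) (reflection l).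
  have := represents_reflection l; rewrite aE bE cE.
  have -> : - (t * zr k * zr b) = (t * zr k) * zr (Z.opp b) by rewrite zrN mulrN.
  have -> : - (2 * (t * zr k * zr c)) = (t * zr k) * zr (Z.opp (Z.mul 2 c)).
    by rewrite zrN zrM zr_const; ring.
  have -> : 2 * (t * zr k * zr a) = (t * zr k) * zr (Z.mul 2 a).
    by rewrite zrM zr_const; ring.
  by move/(represents_scale _ _ _ _ _ kt0).
have test i n := @trace_dvd _ (reflection l * sg R i)%g n (mrep_mul rE (mrep_side R i)).
have pow i : exists2 n, (0 < n)%N & PSL2Z ((reflection l * sg R i) ^+ n)%g.
  apply: finite_index_power fin _ => //; first exact: PSL2Z_subgroup.
  by apply: (subgroupM subG') => //; apply: GG'; exact: sg_in_group.
have [n0 n00 N0] := pow S0; have [n1 n10 N1] := pow S1; have [n5 n50 N5] := pow S5.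
have d0 : mdet (mmul (Mat (Z.opp b) (Z.opp (Z.mul 2 c)) (Z.mul 2 a) b) (side_mat S0)) = D.
  by rewrite mdet_mul /mdet /D /=; lia.
have d1 : mdet (mmul (Mat (Z.opp b) (Z.opp (Z.mul 2 c)) (Z.mul 2 a) b) (side_mat S1)) = D.
  by rewrite mdet_mul /mdet /D /=; lia.
have d5 : mdet (mmul (Mat (Z.opp b) (Z.opp (Z.mul 2 c)) (Z.mul 2 a) b) (side_mat S5)) =
    Z.mul 11 D.
  by rewrite mdet_mul /mdet /D /=; lia.
have t0' := test S0 n0; rewrite d0 in t0'; have {}t0' := t0' D0 n00 N0.
have t1' := test S1 n1; rewrite d1 in t1'; have {}t1' := t1' D0 n10 N1.
have t5' := test S5 n5; rewrite d5 in t5'; have {}t5' := t5' ltac:(lia) n50 N5.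
have [|||A aA rv] := @root_conditions a b c D prim erefl D0.
- by move: t0'; congr Z.divide; rewrite /=; lia.
- by move: t1'; congr Z.divide; rewrite /=; lia.
- by move: t5'; congr Z.divide; rewrite /=; lia.
have Dv := is_root_disc_gt0 rv.
rewrite (@reflection_scale R (hform_of R Dv) l (t * zr k)) //.
- exact: reflection_root.
- by rewrite /= aE aA zrM zr_const.
Qed.

End Arithmetic.

(** * Geometry of the hexagon *)

Section Polygon.
Variable R : realType.
Notation isom := (isom R).
Notation zr := (@zr R).
Implicit Types (g h : isom) (z w : uhp R) (i j : side) (l : hform R).

(* Forms are affine in the coordinates (Re z, |z|^2), in which geodesics are
   segments of lines and the polygon is an ordinary convex polygon. *)
Definition sqn z : R := xc z ^+ 2 + yc z ^+ 2.

Lemma sqn_gt z : xc z ^+ 2 < sqn z.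
Proof. by rewrite /sqn ltrDl exprn_gt0 ?yc_gt0. Qed.

Lemma hform_val_sqn l z : hform_val l z = qa l * sqn z + qb l * xc z + qc l.
Proof. by []. Qed.

Lemma exists_point (x X : R) : x ^+ 2 < X -> exists z, xc z = x /\ sqn z = X.
Proof.
rewrite -subr_gt0 => X0; have y0 : 0 < Num.sqrt (X - x ^+ 2) by rewrite sqrtr_gt0.
by exists (pt x y0); split=> //; rewrite /sqn /xc /yc /= sqr_sqrtr ?subrKC ?ltW.
Qed.

Lemma uhp_sqn_eq z w : xc z = xc w -> sqn z = sqn w -> z = w.
Proof.
move=> ex; rewrite /sqn ex => /addrI /eqP; rewrite eqrXn2 ?ltW ?yc_gt0 // => /eqP.
exact: uhp_eq.
Qed.

Definition hexagon : set (uhp R) := [set z | forall i, halfplane (hwall R i) z].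

Lemma wall_valE i z : hform_val (hwall R i) z =
  match i with
  | S0 => xc z | S1 => 1 - 2 * xc z | S2 => 22 * sqn z - 22 * xc z + 5
  | S3 => 33 * sqn z - 23 * xc z + 4 | S4 => 33 * sqn z - 20 * xc z + 3
  | S5 => 11 * sqn z - 1
  end.
Proof.
by rewrite hform_val_sqn /hwall; case: i; rewrite /= ?zrNeg ?zr_const; ring.
Qed.

Lemma wall_coefE i : [/\ qa (hwall R i) = match i with
    S0 => 0 | S1 => 0 | S2 => 22 | S3 => 33 | S4 => 33 | S5 => 11 end,
  qb (hwall R i) = match i with
    S0 => 1 | S1 => - 2 | S2 => - 22 | S3 => - 23 | S4 => - 20 | S5 => 0 end &
  qc (hwall R i) = match i with
    S0 => 0 | S1 => 1 | S2 => 5 | S3 => 4 | S4 => 3 | S5 => - 1 end].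
Proof. by case: i; rewrite /hwall /= ?zrNeg ?zr_const; split; ring. Qed.

Local Opaque hwall.

Lemma hexagonP z : hexagon z <->
  [/\ 0 <= xc z, 0 <= 1 - 2 * xc z, 0 <= 22 * sqn z - 22 * xc z + 5 &
  [/\ 0 <= 33 * sqn z - 23 * xc z + 4, 0 <= 33 * sqn z - 20 * xc z + 3 &
      0 <= 11 * sqn z - 1]].
Proof.
split=> [H|[h0 h1 h2 [h3 h4 h5]]].
  have h i := H i; split; [| | |split].
  - by have := h S0; rewrite /halfplane /= wall_valE.
  - by have := h S1; rewrite /halfplane /= wall_valE.
  - by have := h S2; rewrite /halfplane /= wall_valE.
  - by have := h S3; rewrite /halfplane /= wall_valE.
  - by have := h S4; rewrite /halfplane /= wall_valE.
  - by have := h S5; rewrite /halfplane /= wall_valE.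
by case; rewrite /halfplane /= wall_valE.
Qed.

(** Since arcosh t is at least ln t for t >= 1, the crude radius ln (1 + d) is enough. *)
Lemma hdist_coshdist z w (d : R) : 0 < d -> hdist z w < ln (1 + d) ->
  coshdist z w < 1 + d.
Proof.
move=> d0; rewrite /hdist /arcosh; set t := coshdist z w; apply: contraTT.
rewrite -!leNgt => td; rewrite ler_ln ?posrE; last 2 first.
- by rewrite addr_gt0.
- by rewrite ltr_wpDr ?sqrtr_ge0 //; apply: lt_le_trans td; rewrite addr_gt0.
by rewrite (le_trans td) // lerDl sqrtr_ge0.
Qed.

Lemma hexagon_convex : convex_polygon hexagon.
Proof.
split.
  exists 6%N, (fun k => hwall R (nth S0 all_sides k)).
  apply/seteqP; split=> [z H k|z H i]; first exact: H.
  have [k -> //] : exists k : 'I_6, i = nth S0 all_sides k.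
  case: i.
  - by exists (@Ordinal 6 0 isT).
  - by exists (@Ordinal 6 1 isT).
  - by exists (@Ordinal 6 2 isT).
  - by exists (@Ordinal 6 3 isT).
  - by exists (@Ordinal 6 4 isT).
  - by exists (@Ordinal 6 5 isT).
have d0 : 0 < (100%:R)^-1 :> R by rewrite invr_gt0.
exists (pt (4%:R^-1) (@ltr01 R)), (ln (1 + 100%:R^-1)); split.
  by rewrite ln_gt0 // ltrDl.
move=> w /(hdist_coshdist d0); rewrite /coshdist ltrD2l ltr_pdivrMr; last first.
  by rewrite !mulr_gt0 ?yc_gt0.
have y0 := yc_gt0 w.
have -> : xc (pt (4%:R^-1) (@ltr01 R)) = 4%:R^-1 by [].
have -> : yc (pt (4%:R^-1) (@ltr01 R)) = 1 by [].
have sx := sqr_ge0 (4%:R^-1 - xc w); have sy := sqr_ge0 (4 / 5 - yc w).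
have sy' := sqr_ge0 (13 / 10 - yc w); have sx' := sqr_ge0 (8 / 100 - xc w).
move=> near.
have hy1 : 4 / 5 < yc w by nra.
have hy2 : yc w < 13 / 10 by nra.
have hx : (4^-1 - xc w) ^+ 2 < 27 / 1000 by have := sqr_ge0 (1 - yc w); lra.
have hx1 : 8 / 100 < xc w by nra.
have hx2 : xc w < 42 / 100 by nra.
have hX : 64 / 100 <= sqn w by rewrite /sqn; nra.
by apply/hexagonP; clear - hx1 hx2 hX; split; [lra|lra|lra|split; lra].
Qed.

Lemma wall_side i : side_of hexagon (hwall R i).
Proof.
(* Two points of the side are supplied by their coordinates (Re z, |z|^2). *)
have two (x X x' X' : R) : x ^+ 2 < X -> x' ^+ 2 < X' -> x < x' \/ X < X' ->
    (forall z, xc z = x -> sqn z = X -> (hexagon `&` geodesic (hwall R i)) z) ->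
    (forall z, xc z = x' -> sqn z = X' -> (hexagon `&` geodesic (hwall R i)) z) ->
    side_of hexagon (hwall R i).
  move=> /exists_point[z [zx zX]] /exists_point[w [wx wX]] ne Hz Hw.
  split; first by move=> u; apply.
  exists z, w; split; [|exact: Hz|exact: Hw].
  by move=> e; move: ne; rewrite -zx -wx -zX -wX e !ltxx => -[].
case: i two => two.
- apply: (@two 0 1 0 2); [lra|lra|by right; lra| |].
    move=> z zx zX; split; last by rewrite /geodesic /= wall_valE zx.
    by apply/hexagonP; rewrite zx zX; do ?split; lra.
  move=> z zx zX; split; last by rewrite /geodesic /= wall_valE zx.
  by apply/hexagonP; rewrite zx zX; do ?split; lra.
- apply: (@two (1 / 2) 1 (1 / 2) 2); [lra|lra|by right; lra| |].
    move=> z zx zX; split; last by rewrite /geodesic /= wall_valE zx; lra.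
    by apply/hexagonP; rewrite zx zX; do ?split; lra.
  move=> z zx zX; split; last by rewrite /geodesic /= wall_valE zx; lra.
  by apply/hexagonP; rewrite zx zX; do ?split; lra.
- apply: (@two (2 / 5) (19 / 110) (9 / 20) (49 / 220)); [lra|lra|by left; lra| |].
    move=> z zx zX; split; last by rewrite /geodesic /= wall_valE zx zX; lra.
    by apply/hexagonP; rewrite zx zX; do ?split; lra.
  move=> z zx zX; split; last by rewrite /geodesic /= wall_valE zx zX; lra.
  by apply/hexagonP; rewrite zx zX; do ?split; lra.
- apply: (@two (17 / 50) (191 / 1650) (7 / 20) (27 / 220)); [lra|lra|by left; lra| |].
    move=> z zx zX; split; last by rewrite /geodesic /= wall_valE zx zX; lra.
    by apply/hexagonP; rewrite zx zX; do ?split; lra.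
  move=> z zx zX; split; last by rewrite /geodesic /= wall_valE zx zX; lra.
  by apply/hexagonP; rewrite zx zX; do ?split; lra.
- apply: (@two (3 / 10) (1 / 11) (8 / 25) (17 / 165)); [lra|lra|by left; lra| |].
    move=> z zx zX; split; last by rewrite /geodesic /= wall_valE zx zX; lra.
    by apply/hexagonP; rewrite zx zX; do ?split; lra.
  move=> z zx zX; split; last by rewrite /geodesic /= wall_valE zx zX; lra.
  by apply/hexagonP; rewrite zx zX; do ?split; lra.
apply: (@two 0 (1 / 11) (3 / 10) (1 / 11)); [lra|lra|by left; lra| |].
  move=> z zx zX; split; last by rewrite /geodesic /= wall_valE zX; lra.
  by apply/hexagonP; rewrite zx zX; do ?split; lra.
move=> z zx zX; split; last by rewrite /geodesic /= wall_valE zX; lra.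
by apply/hexagonP; rewrite zx zX; do ?split; lra.
Qed.

Lemma geodesic_two_points l l' z w : z <> w ->
  geodesic l z -> geodesic l w -> geodesic l' z -> geodesic l' w ->
  exists t, [/\ t != 0, qa l = t * qa l', qb l = t * qb l' & qc l = t * qc l'].
Proof.
move=> zw; rewrite /geodesic /= !hform_val_sqn.
have d0 := disc_gt0 l; have d0' := disc_gt0 l'.
move: d0 d0'; set a := qa l; set b := qb l; set c := qc l.
set a' := qa l'; set b' := qb l'; set c' := qc l' => d0 d0' lz lw l'z l'w.
pose dx := xc z - xc w; pose dX := sqn z - sqn w.
have e1 : a * dX + b * dx = 0 by rewrite /dX /dx; lra.
have e2 : a' * dX + b' * dx = 0 by rewrite /dX /dx; lra.
have [dx0|dx0] := eqVneq dx 0.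
  have dX0 : dX != 0.
    apply/eqP => dX0; apply: zw; apply: uhp_sqn_eq; apply/eqP; rewrite -subr_eq0; exact/eqP.
  have a0 : a = 0 by apply: (mulIf dX0); rewrite mul0r; move: e1; rewrite dx0; lra.
  have a0' : a' = 0 by apply: (mulIf dX0); rewrite mul0r; move: e2; rewrite dx0; lra.
  have b0 : b != 0 by apply: contraTneq d0 => ->; rewrite a0; lra.
  have b0' : b' != 0 by apply: contraTneq d0' => ->; rewrite a0'; lra.
  exists (b / b'); split; first by rewrite mulf_neq0 ?invr_eq0.
  - by rewrite a0 a0' mulr0.
  - by rewrite divfK.
  have cE : c = - (b * xc z) by move: lz; rewrite a0; lra.
  have cE' : c' = - (b' * xc z) by move: l'z; rewrite a0'; lra.
  by rewrite cE cE'; field.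
have bE : b = - (a * dX / dx) by apply: (mulIf dx0); rewrite mulNr divfK //; lra.
have bE' : b' = - (a' * dX / dx) by apply: (mulIf dx0); rewrite mulNr divfK //; lra.
have a0 : a != 0 by apply: contraTneq d0 => a0; rewrite bE a0; lra.
have a0' : a' != 0 by apply: contraTneq d0' => a0'; rewrite bE' a0'; lra.
exists (a / a'); split; first by rewrite mulf_neq0 ?invr_eq0.
- by rewrite divfK.
- by rewrite bE bE'; field; rewrite dx0 a0'.
have cE : c = - (a * sqn z + b * xc z) by lra.
have cE' : c' = - (a' * sqn z + b' * xc z) by lra.
by rewrite cE cE' bE bE'; field; rewrite dx0 a0'.
Qed.

Lemma small_perturbation (s : seq (R * R)) : all (fun p => 0 < p.1) s ->
  exists2 e, 0 < e & forall e', 0 < e' <= e -> all (fun p => 0 < p.1 - e' * p.2) s.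
Proof.
elim: s => [|[c k] s IHs] /=; first by exists 1.
move=> /andP[c0 /IHs[e e0 He]].
have k0 : 0 < `|k| + 1 by rewrite ltr_wpDl.
exists (Num.min e (c / (2 * (`|k| + 1)))).
  by rewrite lt_min e0 divr_gt0 // mulr_gt0.
move=> e'; rewrite le_min => /and3P[e'0 e'e e'c].
rewrite He ?e'0 // andbT subr_gt0; move: e'c; rewrite ler_pdivlMr ?mulr_gt0 // => e'c.
have := ler_norm k; move: (`|k|) k0 e'c => m m0 e'c km; nra.
Qed.

(** If no wall contains both points, their midpoint in the coordinates (Re z, |z|^2) is strictly
    inside every wall but still on the line of l. A small step against the normal (a, b) then leaves
    the half-plane of l while staying in the hexagon. *)
Lemma side_of_hexagon l : side_of hexagon l ->
  exists i t, [/\ t != 0, qa l = t * qa (hwall R i), qb l = t * qb (hwall R i) &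
                  qc l = t * qc (hwall R i)].
Proof.
move=> [sub [z [w [zw [Qz lz] [Qw lw]]]]].
suff [i [iz iw]] : exists i, geodesic (hwall R i) z /\ geodesic (hwall R i) w.
  by exists i; apply: geodesic_two_points zw lz lw iz iw.
pose xm := (xc z + xc w) / 2; pose Xm := (sqn z + sqn w) / 2.
have mid (l' : hform R) : qa l' * Xm + qb l' * xm + qc l' =
    (hform_val l' z + hform_val l' w) / 2.
  by rewrite !hform_val_sqn /xm /Xm; field.
apply: contrapT => none.
have pos i : 0 < qa (hwall R i) * Xm + qb (hwall R i) * xm + qc (hwall R i).
  rewrite mid; have := Qz i; have := Qw i; rewrite /halfplane /= => iw iz.
  rewrite divr_gt0 // lt_neqAle addr_ge0 // andbT eq_sym paddr_eq0 //.
  by apply/negP => /andP[/eqP e1 /eqP e2]; apply: none; exists i.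
have Xm0 : 0 < Xm - xm ^+ 2.
  have := sqn_gt z; have := sqn_gt w; rewrite /Xm /xm.
  have := sqr_ge0 (xc z - xc w); nra.
pose a := qa l; pose b := qb l.
(* The first entry keeps the displaced point in the upper half-plane, the second gives e < 1 so that
   e^2 b^2 is at most e b^2, and the others keep it inside the six walls. *)
have [|e e0 He] := @small_perturbation ((Xm - xm ^+ 2, a - 2 * xm * b + b ^+ 2) ::
    (1, 1) :: [seq (qa (hwall R i) * Xm + qb (hwall R i) * xm + qc (hwall R i),
       qa (hwall R i) * a + qb (hwall R i) * b) | i <- all_sides]).
  by rewrite /= Xm0 ltr01 !pos.
have := He e; rewrite e0 lexx => /(_ isT) /= /and3P[e1 e2 /and5P[w0 w1 w2 w3 /and3P[w4 w5 _]]].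
have [|u [ux uX]] := @exists_point (xm - e * b) (Xm - e * a).
  have : e ^+ 2 * b ^+ 2 <= e * b ^+ 2 by rewrite ler_wpM2r ?sqr_ge0 //; nra.
  move: e1; lra.
have Qu : hexagon u.
  move=> i; rewrite /halfplane /= hform_val_sqn ux uX; apply: ltW.
  have E (k c' d : R) : 0 < k * Xm + c' * xm + d - e * (k * a + c' * b) ->
    0 < k * (Xm - e * a) + c' * (xm - e * b) + d by lra.
  by case: i; apply: E.
have := sub _ Qu; rewrite /halfplane /= hform_val_sqn ux uX leNgt => /negP; apply.
have l0 : a * Xm + b * xm + qc l = 0 by rewrite /a /b mid lz lw addr0 mul0r.
have ab0 : 0 < a ^+ 2 + b ^+ 2.
  rewrite lt_neqAle addr_ge0 ?sqr_ge0 // andbT eq_sym paddr_eq0 ?sqr_ge0 //.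
  rewrite !sqrf_eq0; apply/negP => /andP[/eqP aE /eqP bE].
  by have := disc_gt0 l; rewrite -/a -/b aE bE; lra.
rewrite -/a -/b.
have -> : a * (Xm - e * a) + b * (xm - e * b) + qc l = - (e * (a ^+ 2 + b ^+ 2)).
  by lra.
by rewrite oppr_lt0 mulr_gt0.
Qed.

Lemma hexagon_reflections : [set reflection l | l in side_of hexagon] = range (sg R).
Proof.
apply/seteqP; split=> [_ [l /side_of_hexagon[i [t [t0 eA eB eC]]] <-]|_ [i _ <-]].
  by exists i => //; rewrite (@reflection_scale R (hwall R i) l t).
by exists (hwall R i) => //; exact: wall_side.
Qed.

(** In the coordinates (Re z, |z|^2) two walls meet in at most one point, found linearly.
    Non-adjacent walls meet outside the hexagon or not at all; adjacent ones meeting in the plane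
    are orthogonal. *)
Lemma walls_orthogonal i j z : hexagon z -> i <> j ->
  geodesic (hwall R i) z -> geodesic (hwall R j) z ->
  qb (hwall R i) * qb (hwall R j) - 2 * qa (hwall R i) * qc (hwall R j)
    - 2 * qa (hwall R j) * qc (hwall R i) = 0.
Proof.
move=> /hexagonP Qz ij; rewrite /geodesic /= !wall_valE.
have Xx := sqn_gt z; move: Qz Xx.
move: (xc z) (sqn z) => x X [h0 h1 h2 [h3 h4 h5]] Xx.
(* Tangents to the parabola X = x^2 make the condition x^2 < X linear. The one at 1/3 excludes the
   ideal vertex, where [S3] and [S4] meet on the parabola itself. *)
have sq (c : R) : 2 * c * x - c ^+ 2 < X by have := sqr_ge0 (x - c); lra.
have s0 := sq 0; have s1 := sq (1 / 2); have s2 := sq (1 / 3).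
have s3 := sq (9 / 26); have s4 := sq (7 / 22); have s5 := sq (7 / 23).
clear Xx sq.
have [a1 b1 c1] := wall_coefE i; have [a2 b2 c2] := wall_coefE j.
case: i ij a1 b1 c1; case: j a2 b2 c2 => a2 b2 c2 ij a1 b1 c1; (try by case: ij);
  clear ij => e1 e2; rewrite ?a1 ?b1 ?c1 ?a2 ?b2 ?c2; lra.
Qed.

Lemma hexagon_angles : submultiple_angles hexagon.
Proof.
move=> l1 l2 z /side_of_hexagon[i [t [t0 eA eB eC]]] /side_of_hexagon[j [s [s0 fA fB fC]]].
move=> ne Qz l1z l2z.
have geo l i' t' : t' != 0 -> qa l = t' * qa (hwall R i') -> qb l = t' * qb (hwall R i') ->
    qc l = t' * qc (hwall R i') -> geodesic l = geodesic (hwall R i').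
  move=> t'0 hA hB hC; apply/seteqP; split=> u; rewrite /geodesic /= !hform_val_sqn hA hB hC.
    by rewrite -!mulrA -!mulrDr => /eqP; rewrite mulf_eq0 (negPf t'0) => /eqP.
  by rewrite -!mulrA -!mulrDr => ->; rewrite mulr0.
have iz : geodesic (hwall R i) z by rewrite -(geo l1 i t).
have jz : geodesic (hwall R j) z by rewrite -(geo l2 j s).
have ij : i <> j by move=> ij; apply: ne; rewrite (geo l1 i t) // (geo l2 j s) // ij.
have orth := walls_orthogonal Qz ij iz jz.
exists 2%N; split=> //; rewrite /interior_angle.
have -> : dot (grad l1 z) (grad l2 z) = 0.
  rewrite /dot /grad /= eA eB fA fB.
  move: iz jz; rewrite /geodesic /= !hform_val_sqn /sqn => iz jz.
  move: orth iz jz; move: (qa (hwall R i)) (qb (hwall R i)) (qc (hwall R i)).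
  move: (qa (hwall R j)) (qb (hwall R j)) (qc (hwall R j)) (xc z) (yc z).
  move=> a b c x y a' b' c' orth iz jz.
  have -> : (2 * (t * a') * x + t * b') * (2 * (s * a) * x + s * b) +
      2 * (t * a') * y * (2 * (s * a) * y) =
      t * s * (2 * a * (a' * (x ^+ 2 + y ^+ 2) + b' * x + c') +
               2 * a' * (a * (x ^+ 2 + y ^+ 2) + b * x + c) +
               (b' * b - 2 * a' * c - 2 * a * c')) by ring.
  by rewrite iz jz orth; ring.
by rewrite mul0r acos0; field.
Qed.

(** * Discreteness and non-cocompactness *)

Lemma coshdist_close z w : coshdist w z < 1 + 100%:R^-1 ->
  1 <= yc z -> 0 <= xc z <= 1 ->
  `|(yc w)^-1 - (yc z)^-1| < 2^-1 /\ `|xc w / yc w - xc z / yc z| < 2^-1.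
Proof.
have y0 := yc_gt0 z; have v0 := yc_gt0 w.
rewrite /coshdist ltrD2l; move: (xc z) (yc z) (xc w) (yc w) y0 v0 => x y u v y0 v0 near y1 x1.
pose k := y / v; pose a := (u - x) / v.
have k0 : 0 < k by rewrite divr_gt0.
have key : a ^+ 2 + (1 - k) ^+ 2 < k / 50.
  have -> : a ^+ 2 + (1 - k) ^+ 2 = 2 * k * (((u - x) ^+ 2 + (v - y) ^+ 2) / (2 * v * y)).
    by rewrite /a /k; field; rewrite !gt_eqF.
  have -> : k / 50 = 2 * k * 100^-1 by field.
  by rewrite ltr_pM2l // mulr_gt0.
have k1 : k < 12 / 10 by have := sqr_ge0 a; nra.
have k2 : 8 / 10 < k by have := sqr_ge0 a; nra.
have a2 : a ^+ 2 < 4 / 100 by have := sqr_ge0 (1 - k); lra.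
have a1 : `|a| < 2 / 10 by rewrite -ltr_sqr ?nnegrE // real_normK ?num_real //; lra.
have yV : 0 < y^-1 <= 1 by rewrite invr_gt0 y0 invf_le1.
have vE : v^-1 - y^-1 = (k - 1) * y^-1 by rewrite /k; field; rewrite !gt_eqF.
have vb : `|v^-1 - y^-1| < 2 / 10.
  rewrite vE normrM (gtr0_norm (_ : 0 < y^-1)); last by case/andP: yV.
  have : `|k - 1| < 2 / 10 by rewrite ltr_norml; apply/andP; split; lra.
  have := normr_ge0 (k - 1); move: (`|k - 1|) (y^-1) yV => m s /andP[s0 s1] m0 m1; nra.
split; first by apply: lt_trans vb _; lra.
have -> : u / v - x / y = a + x * (v^-1 - y^-1) by rewrite /a; ring.
clearbody a.
apply: le_lt_trans (ler_normD _ _) _; rewrite normrM.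
have : `|x| <= 1 by case/andP: x1 => x0 x1; rewrite ger0_norm.
have := normr_ge0 x; have := normr_ge0 (v^-1 - y^-1).
move: (`|x|) (`|v^-1 - y^-1|) (`|a|) vb a1 => m s p sb p1 s0 m0 m1.
have : m * s <= s by rewrite ler_piMl.
lra.
Qed.

Lemma zr_lt x y : zr x < zr y -> Z.lt x y.
Proof. by rewrite -subr_gt0 -zrB zr_gt0 => /Z.ltb_lt; lia. Qed.

Lemma zr_norm_lt1 x y : `|zr x - zr y| < 1 -> x = y.
Proof.
rewrite ltr_norml => /andP[h1 h2].
have : zr x < zr (Z.add y 1) by rewrite zrD zr_const; lra.
have : zr y < zr (Z.add x 1) by rewrite zrD zr_const; lra.
move=> /zr_lt + /zr_lt; lia.
Qed.

(** The functions 1/y and x/y pull back to integer forms, which are determined by their values at i,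
    2i and 1 + i. These values lie in Z, or in Z/2 at 2i, so an element moving them by less than 1/2
    fixes both functions and is the identity. *)
Lemma hexagon_group_discrete : discrete_subgroup (@hexagon_group R).
Proof.
pose p1 := pt 0 (@ltr01 R); pose p2 := pt 0 (@ltr0n R 2); pose p3 := pt 1 (@ltr01 R).
have d0 : 0 < (100%:R)^-1 :> R by rewrite invr_gt0.
exists [set p1; p2; p3], (ln (1 + 100%:R^-1)); split.
- by rewrite !finite_setU; do !split; exact: finite_set1.
- by rewrite ln_gt0 // ltrDl.
move=> _ [w _ <-] near.
have close z : [set p1; p2; p3] z -> 1 <= yc z -> 0 <= xc z <= 1 ->
  `|(yc (gw R w z))^-1 - (yc z)^-1| < 2^-1 /\
  `|xc (gw R w z) / yc (gw R w z) - xc z / yc z| < 2^-1.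
  by move=> /near /(hdist_coshdist d0); exact: coshdist_close.
have eY z : (yc (gw R w z))^-1 = fval (act (Form 0 0 1) w) z.
  by rewrite -fval_gw /fval /fv !zr_const; ring.
have eX z : xc (gw R w z) / yc (gw R w z) = fval (act (Form 0 1 0) w) z.
  by rewrite -fval_gw /fval /fv !zr_const; ring.
have [c11 c12] : _ /\ _ := close p1 (or_introl (or_introl erefl))
  ltac:(rewrite /yc /=; lra) ltac:(rewrite /xc /=; lra).
have [c21 c22] : _ /\ _ := close p2 (or_introl (or_intror erefl))
  ltac:(rewrite /yc /=; lra) ltac:(rewrite /xc /=; lra).
have [c31 c32] : _ /\ _ := close p3 (or_intror erefl)
  ltac:(rewrite /yc /=; lra) ltac:(rewrite /xc /=; lra).
rewrite !eY in c11 c21 c31; rewrite !eX in c12 c22 c32.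
have lin A b c : fval (Form A b c) p1 = zr (Z.add (Z.mul 11 A) c) /\
   fval (Form A b c) p2 = zr (Z.add (Z.mul 44 A) c) / 2 /\
   fval (Form A b c) p3 = zr (Z.add (Z.add (Z.mul 22 A) b) c).
  by rewrite /fval /fv /xc /yc /= !zrE !zr_const; split; [field|split; field].
have y1 : yc p1 = 1 by []. have y2 : yc p2 = 2 by []. have y3 : yc p3 = 1 by [].
have x1 : xc p1 = 0 by []. have x2 : xc p2 = 0 by []. have x3 : xc p3 = 1 by [].
have fixY : act (Form 0 0 1) w = Form 0 0 1.
  case: (act _ w) c11 c21 c31 => A b c; have [-> [-> ->]] := lin A b c.
  rewrite y1 y2 y3 invr1 -[1]/(zr 1) => c1 c2 c3.
  have e1 : Z.add (Z.mul 11 A) c = Zpos xH by apply: zr_norm_lt1; lra.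
  have e2 : Z.add (Z.mul 44 A) c = Zpos xH.
    apply: zr_norm_lt1; move: c2; rewrite !ltr_norml => /andP[? ?]; apply/andP; split; lra.
  have e3 : Z.add (Z.add (Z.mul 22 A) b) c = Zpos xH by apply: zr_norm_lt1; lra.
  by congr Form; clear - e1 e2 e3; lia.
have fixX : act (Form 0 1 0) w = Form 0 1 0.
  case: (act _ w) c12 c22 c32 => A b c; have [-> [-> ->]] := lin A b c.
  rewrite y1 y2 y3 x1 x2 x3 !mul0r divr1 -[1]/(zr 1) -[X in `|_ - X|]/(zr 0) => c1 c2 c3.
  have e1 : Z.add (Z.mul 11 A) c = Z0.
    by apply: zr_norm_lt1; rewrite zr_const; move: c1; rewrite ?zr_const; lra.
  have e2 : Z.add (Z.mul 44 A) c = Z0.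
    apply: zr_norm_lt1; rewrite zr_const; move: c2.
    by rewrite ?zr_const !ltr_norml => /andP[? ?]; apply/andP; split; lra.
  have e3 : Z.add (Z.add (Z.mul 22 A) b) c = Zpos xH by apply: zr_norm_lt1; lra.
  by congr Form; clear - e1 e2 e3; lia.
apply: isom_ext => z; rewrite isom1E; apply: fv_eq => b c.
have := eX z; have := eY z; rewrite fixY fixX /fval /fv !zr_const => hY hX.
rewrite /fv mul0r !add0r !mulrDl.
have -> : b * xc (gw R w z) / yc (gw R w z) = b * (xc (gw R w z) / yc (gw R w z)).
  by rewrite mulrA.
by rewrite hX hY; ring.
Qed.

(** The function 1/y pulls back to positive integer forms of discriminant 0. Such a form has A = 0
    and c >= 1, or A >= 1, so all of them share a positive lower bound on a compact set. If
    translates of that set covered the plane, 1/y would be bounded below, but it tends to 0 at the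
    cusp oo. *)
Lemma hexagon_group_not_cocompact : ~ cocompact (@hexagon_group R).
Proof.
move=> [K [cK cover]].
pose Y := snd @` (@coords R @` K).
have cY : compact Y.
  apply: continuous_compact cK; apply: continuous_subspaceT => p; exact: cvg_snd.
have [M [_ YM]] := compact_bounded cY.
have YB : forall w, K w -> yc w <= M + 1.
  move=> w Kw; apply: le_trans (ler_norm _) _; apply: (YM (M + 1)); first by rewrite ltrDl.
  by exists (coords w) => //; exists w.
have [m m0 Ym] : exists2 m, 0 < m & forall w, K w -> m <= yc w.
  have Y0 : ~ Y 0.
    by move=> [_ [w _ <-]] /= y0; have := yc_gt0 w; rewrite y0 ltxx.
  have oY : open (~` Y).
    by apply: closed_openC; apply: compact_closed cY; exact: norm_hausdorff.
  have /nbhs_ballP[e /= e0 He] : nbhs (0 : R) (~` Y) by apply: open_nbhs_nbhs.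
  exists e => // w Kw; rewrite leNgt; apply/negP => ye; apply: (He (yc w)).
    by rewrite /ball /= sub0r normrN gtr0_norm ?yc_gt0.
  by exists (coords w) => //; exists w.
have [w0 Kw0] : exists w, K w by have [g [w [_ Kw _]]] := cover (pt 0 ltr01); exists w.
have M1 : 0 < M + 1 by apply: lt_le_trans (YB _ Kw0); apply: yc_gt0.
pose e := Num.min m (M + 1)^-1.
have e0 : 0 < e by rewrite lt_min m0 invr_gt0.
suff low z : e <= (yc z)^-1.
  have y0 : 0 < 2 / e by rewrite divr_gt0.
  have := low (pt 0 y0); rewrite /yc /= invf_div; lra.
have [_ [u [[w _ <-] Ku ->]]] := cover z.
have -> : (yc (gw R w u))^-1 = fval (act (Form 0 0 1) w) u.
  by rewrite -fval_gw /fval /fv !zr_const; ring.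
have pos : 0 < fval (act (Form 0 0 1) w) u.
  rewrite -fval_gw /fval /fv !zr_const mulr0 mul0r mul0r !add0r mul1r invr_gt0.
  exact: yc_gt0.
have := disc_act (Form 0 0 1) w; rewrite {2}/disc /=.
case: (act _ w) pos => A b c; rewrite /disc /fval /fv /= => pos dE.
have uy := yc_gt0 u; have um := Ym _ Ku; have uM := YB _ Ku.
have ge1 x : 0 < zr x -> 1 <= zr x.
  rewrite zr_gt0 => /Z.ltb_lt x0; rewrite -subr_ge0 -[1]/(zr 1) -zrB leNgt.
  rewrite -oppr_gt0 -zrN zr_gt0; apply/negP => /Z.ltb_lt; lia.
have dR : zr b ^+ 2 = 44 * zr A * zr c.
  have -> : zr b ^+ 2 = zr (Z.mul b b) by rewrite zrM.
  by rewrite (_ : Z.mul b b = Z.mul (Z.mul 44 A) c); [rewrite !zrM zr_const|lia].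
have [A0|A0] := eqVneq (zr A) 0.
  have b0 : zr b = 0 by apply/eqP; rewrite -sqrf_eq0 dR A0 mulr0 mul0r.
  move: pos; rewrite A0 b0 mulr0 !mul0r !add0r => pos.
  have c1 : 1 <= zr c by apply: ge1; move: pos; rewrite pmulr_lgt0 ?invr_gt0.
  rewrite ge_min; apply/orP; right.
  apply: le_trans (_ : (yc u)^-1 <= _); first by rewrite lef_pV2 ?posrE.
  by rewrite ler_peMl // invr_ge0 ltW.
have sq : 44 * zr A * (11 * zr A * (xc u ^+ 2 + yc u ^+ 2) + zr b * xc u + zr c) =
    (22 * zr A * xc u + zr b) ^+ 2 + (22 * zr A * yc u) ^+ 2 by ring: dR.
have pos' : 0 < 11 * zr A * (xc u ^+ 2 + yc u ^+ 2) + zr b * xc u + zr c.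
  by move: pos; rewrite pmulr_lgt0 ?invr_gt0.
have A1 : 1 <= zr A.
  apply: ge1.
  have : 0 < 44 * zr A * (11 * zr A * (xc u ^+ 2 + yc u ^+ 2) + zr b * xc u + zr c).
    rewrite sq ltr_wpDl ?sqr_ge0 // exprn_even_gt0 //= !mulf_neq0 ?pnatr_eq0 //.
    by rewrite gt_eqF.
  by rewrite pmulr_lgt0 // pmulr_rgt0.
rewrite ge_min; apply/orP; left; rewrite ler_pdivlMr //.
have : 44 * zr A * (m * yc u) <=
    44 * zr A * (11 * zr A * (xc u ^+ 2 + yc u ^+ 2) + zr b * xc u + zr c).
  rewrite sq; have := sqr_ge0 (22 * zr A * xc u + zr b).
  have : 44 * zr A * (m * yc u) <= (22 * zr A * yc u) ^+ 2.
    have -> : (22 * zr A * yc u) ^+ 2 = 44 * zr A * (11 * zr A * yc u * yc u) by ring.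
    rewrite ler_pM2l ?mulr_gt0 //; last by lra.
    by rewrite ler_pM2r //; nra.
  lra.
by rewrite ler_pM2l // mulr_gt0 //; lra.
Qed.

End Polygon.

(** * Finite area *)

Lemma ge0_le_integral_nonmeasurable d (T : measurableType d) (R : realType)
    (mu : {measure set T -> \bar R}) (D : set T) (f g : T -> \bar R) :
  (forall x, D x -> (0 <= f x)%E) -> (forall x, (0 <= g x)%E) ->
  (forall x, D x -> (f x <= g x)%E) ->
  (\int[mu]_(x in D) f x <= \int[mu]_x g x)%E.
Proof.
move=> f0 g0 fg; rewrite ge0_integralE // ge0_integralTE //.
(* The integral of a nonnegative function is a supremum over the simple functions below it, so the
   comparison holds without measurability of f or of D, here the hexagon. *)
apply: le_ereal_sup => _ [h hf <-]; exists h => // x.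
apply: le_trans (hf x) _; rewrite patchE; case: ifPn => [|_]; last exact: g0.
by rewrite inE; exact: fg.
Qed.

(** With t = x - 1/3 and s = y^2, walls [S4] and [S3] read 33 t^2 + 2 t + 33 s >= 0 and 33 t^2 - t +
    33 s >= 0. For t in [-1/17, 1/34] this bounds |t| by 33 times 34, that is 1122, times s; further
    away s is bounded below, and 1200 covers both cases. *)
Lemma hexagon_cusp (R : realType) (z : uhp R) : hexagon z -> `|xc z - 1 / 3| <= 1200 * yc z ^+ 2.
Proof.
move=> /hexagonP[]; rewrite /sqn; set x := xc z; set s := yc z ^+ 2.
have s0 : 0 <= s by exact: sqr_ge0.
move=> h0 h1 h2 [h3 h4 h5].
pose t := x - 1 / 3; have xE : x = t + 1 / 3 by rewrite /t; ring.
move: h0 h1 h2 h3 h4 h5; rewrite xE => h0 h1 h2 h3 h4 h5.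
have -> : t + 1 / 3 - 1 / 3 = t by ring.
clearbody t s; clear xE x.
rewrite ler_norml; apply/andP; split.
  case: (lerP 0 t) => t0; first by lra.
  case: (lerP (- (1 / 17)) t) => t1; first by nra.
  nra.
case: (lerP t 0) => t0; first by lra.
case: (lerP t (1 / 34)) => t1; first by nra.
nra.
Qed.

Section Majorant.
Variable R : realType.
Let mu := @lebesgue_measure R.
Variable K : R.
Hypothesis K0 : 0 <= K.

(** The first term controls the cusp at 1/3, the second the cusp at oo. *)
Definition cusp_width (y : R) : R := Num.min (K * y ^+ 2) 1.

Lemma cusp_width_ge0 y : 0 <= cusp_width y.
Proof. by rewrite le_min ler01 mulr_ge0 ?sqr_ge0. Qed.

Definition weight : R -> R := (fun y : R => (y ^- 2 : R)) \_ `]0, +oo[.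

Lemma weight_ge0 y : 0 <= weight y.
Proof. by rewrite /weight patchE; case: ifP => // _; rewrite invr_ge0 sqr_ge0. Qed.

Lemma measurable_weight : measurable_fun setT weight.
Proof.
apply/(measurable_restrictT _ _).1; first exact: measurable_itv.
apply: subspace_continuous_measurable_fun; first exact: measurable_itv.
apply: continuous_in_subspaceT => y; rewrite inE /= in_itv /= andbT => y0.
by apply: cvgV; [rewrite expf_neq0 // gt_eqF|exact: exprn_continuous].
Qed.

Lemma measurable_cusp_width : measurable_fun setT cusp_width.
Proof.
apply: measurable_minr; last exact: measurable_cst.
by apply: measurable_funM; [exact: measurable_cst|apply: measurable_funX].
Qed.

Definition cusp_region : set (R * R) :=
  [set p | 1 / 3 - cusp_width p.2 <= p.1] `&` [set p | p.1 <= 1 / 3 + cusp_width p.2].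

Lemma measurable_cusp_region : measurable cusp_region.
Proof.
have mw : measurable_fun setT (fun p : R * R => cusp_width p.2).
  exact: measurableT_comp measurable_cusp_width measurable_snd.
apply: measurableI; rewrite -[X in measurable X]setTI; apply: measurable_fun_le => //.
- by apply: measurable_funB => //; exact: measurable_cst.
- by apply: measurable_funD => //; exact: measurable_cst.
Qed.

Definition majorant (p : R * R) : \bar R := (weight p.2 * \1_cusp_region p)%:E.

Lemma majorant_ge0 p : (0 <= majorant p)%E.
Proof. by rewrite lee_fin mulr_ge0 ?weight_ge0. Qed.

Lemma measurable_majorant : measurable_fun setT majorant.
Proof.
apply/measurable_EFinP; apply: measurable_funM.
  exact: measurableT_comp measurable_weight measurable_snd.
by apply: measurable_indic; exact: measurable_cusp_region.
Qed.

(** From w <= K y^2 and w <= 1 follows w (1 + y^2) <= (K + 1) y^2, so each horizontal slice is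
    dominated by a multiple of 1 / (1 + y^2), the integrable derivative of the arctangent. *)
Lemma fubini_majorant y : (fubini_G mu majorant y <=
  (((2 * (K + 1))%:E * (oneDsqr y)^-1%:E) * (\1_(`[0%R, +oo[ : set R) y)%:E))%E.
Proof.
rewrite /fubini_G /majorant /=.
under eq_integral do rewrite EFinM.
have mS : measurable [set x | cusp_region (x, y)].
  have := measurable_ysection y measurable_cusp_region.
  by rewrite ysectionE.
have -> : (\int[mu]_x ((weight y)%:E * (\1_cusp_region (x, y))%:E))%E =
    ((weight y)%:E * mu [set x | cusp_region (x, y)])%E.
  rewrite ge0_integralZl //=; last 2 first.
  - apply/measurable_EFinP; exact: (measurable_indic mS).
  - by rewrite lee_fin weight_ge0.
  have := @integral_indic _ _ R (@lebesgue_measure R) setT measurableT _ mS.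
  by rewrite setIT => E; congr (_ * _)%E; exact: E.
have -> : [set x | cusp_region (x, y)] =
    [set` `[1 / 3 - cusp_width y, 1 / 3 + cusp_width y]].
  apply/seteqP; split=> x; rewrite /cusp_region /= in_itv /=.
    by move=> [-> ->].
  by move=> /andP[].
rewrite /mu lebesgue_measure_itv /=.
have w0 := cusp_width_ge0 y.
have [y0|y0] := lerP y 0.
  rewrite /weight patchE ifF ?mul0e; last first.
    by apply/negbTE; rewrite notin_setE /= in_itv /= andbT => /lt_geF; rewrite y0.
  by rewrite !mule_ge0 // lee_fin // ?mulr_ge0 ?addr_ge0 // invr_ge0
    (le_trans ler01) // oneDsqr_ge1.
have -> : weight y = y ^- 2 by rewrite /weight patchE ifT // inE /= in_itv /= andbT.
have -> : \1_(`[0%R, +oo[ : set R) y = 1 :> R.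
  by rewrite indicE mem_set //= in_itv /= andbT ltW.
rewrite mule1 -EFinM.
have y2 : 0 < y ^+ 2 by rewrite exprn_gt0.
apply: le_trans (_ : ((y ^- 2 * (2 * cusp_width y))%:E <= _)%E).
  rewrite EFinM lee_wpmul2l ?lee_fin ?invr_ge0 ?sqr_ge0 //.
  case: ifP => _; first by rewrite -EFinB lee_fin; lra.
  by rewrite lee_fin mulr_ge0.
rewrite lee_fin mulrC ler_pdivrMr // /oneDsqr.
have d0 : 0 < 1 + y ^+ 2 by rewrite addr_gt0.
rewrite mulrAC ler_pdivlMr //.
have : cusp_width y <= K * y ^+ 2 by rewrite ge_min lexx.
have : cusp_width y <= 1 by rewrite ge_min lexx orbT.
move: (cusp_width y) (y ^+ 2) w0 y2 => m s m0 s0 m1 mK; nra.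
Qed.

Lemma integral_majorant : (\int[mu \x mu]_p majorant p < +oo)%E.
Proof.
rewrite /mu (@fubini_tonelli2 _ _ _ _ R (@lebesgue_measure R) (@lebesgue_measure R)
  majorant measurable_majorant majorant_ge0).
apply: le_lt_trans (_ : (_ <= (2 * (K + 1))%:E *
  \int[mu]_(x in `[0%R, +oo[) (oneDsqr x)^-1%:E)%E) _; last first.
  by rewrite integral0y_oneDsqr -EFinM ltry.
have c0 : (0 <= (2 * (K + 1))%:E :> \bar R)%E by rewrite lee_fin mulr_ge0 ?addr_ge0.
have o0 (x : R) : (0 <= (oneDsqr x)^-1%:E)%E.
  by rewrite lee_fin invr_ge0 (le_trans ler01) // oneDsqr_ge1.
have mo : measurable_fun setT (fun x : R => (oneDsqr x)^-1%:E).
  apply/measurable_EFinP; apply: continuous_measurable_fun; exact: continuous_oneDsqrV.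
rewrite -ge0_integralZl //; last exact: measurable_funTS.
rewrite [leRHS]integral_mkcond; apply: ge0_le_integral_nonmeasurable => //.
- by move=> y _; apply: integral_ge0 => x _; exact: majorant_ge0.
- by move=> y; rewrite patchE; case: ifP => // _; rewrite mule_ge0.
move=> y _; apply: le_trans (fubini_majorant y) _.
by rewrite patchE indicE; case: ifP => _; rewrite ?mule1 ?mule0.
Qed.

End Majorant.

Lemma hexagon_area (R : realType) : (harea (@hexagon R) < +oo)%E.
Proof.
have K0 : 0 <= 1200 :> R by lra.
apply: le_lt_trans (integral_majorant K0); apply: ge0_le_integral_nonmeasurable.
- by move=> p _; rewrite lee_fin invr_ge0 sqr_ge0.
- by move=> p; exact: majorant_ge0.
move=> _ [z Qz <-]; rewrite lee_fin /=.
have y0 := yc_gt0 z.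
rewrite /weight patchE ifT; last by rewrite inE /= in_itv /= andbT.
rewrite indicE mem_set ?mulr1 //.
have cusp := hexagon_cusp Qz; have /hexagonP[h0 h1 _ _] := Qz.
have : `|xc z - 1 / 3| <= cusp_width 1200 (yc z).
  by rewrite le_min cusp /= ler_norml; apply/andP; split; lra.
by rewrite ler_norml /cusp_region /= => /andP[h2 h3]; split; lra.
Qed.

(** * Arithmeticity and maximality *)

Lemma hexagon_group_arithmetic (R : realType) : arithmetic_reflection_group (@hexagon_group R).
Proof.
split; [|exact: hexagon_group_not_cocompact|exact: hexagon_group_commensurable].
split; first exact: hexagon_group_discrete.
exists (@hexagon R); split.
- exact: hexagon_convex.
- exact: hexagon_area.
- exact: hexagon_angles.
- by rewrite hexagon_reflections -hexagon_group_generated.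
Qed.

(** As [G'] is generated by its reflections, it is enough to place each of them in the hexagon
    group; other symmetries of the lattice, such as the rotation about z0, never come up. *)
Lemma hexagon_group_maximal (R : realType) (G' : set (isom R)) :
  arithmetic_reflection_group G' -> @hexagon_group R `<=` G' -> G' = @hexagon_group R.
Proof.
move=> [[_ [Q [_ _ _ G'E]]] _ [fin _]] GG'.
have subG' : is_subgroup G' by rewrite G'E; apply: generated_subgroup.
apply/seteqP; split=> // g; rewrite {1}G'E.
apply: smallest_sub; first exact: hexagon_group_subgroup.
move=> _ [l Ql <-]; apply: (reflection_in_group subG' fin GG').
by rewrite G'E; apply: sub_gen_smallest; exists l.
Qed.

Theorem mainTheorem3 (R : realType) :
  exists G : set (isom R), maximal_arithmetic G /\ ~ congruence_group G.
Proof.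
exists (@hexagon_group R); split; last exact: hexagon_group_not_congruence.
by split; [exact: hexagon_group_arithmetic|move=> G' aG'; exact: hexagon_group_maximal].
Qed.
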